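(* Let $G=(V,E^+,E^-)$ be a signed graph with $n=|V|$ vertices and maximum degree $\Delta$, let $\beta\in(0,1]$ be a tolerance parameter, and let $\mathcal{C}>0$ be the iteration constant. With high probability, the expected running time of the algorithm $\mathtt{Sampling}(G,\beta,\mathcal{C},p,T)$ described in the context is $O(\Delta(\mathcal{C}+1)\,n\log^2 n)$; that is, there is an event of high probability conditionally on which the expected running time is $O(\Delta(\mathcal{C}+1)\,n\log^2 n)$.
   Context: A signed graph is a finite undirected simple graph $G=(V,E^+,E^-)$ whose edge set is partitioned into positive edges $E^+$ and negative edges $E^-$. $N(x)$ denotes the set of neighbours of $x$, and $G[S]$ the subgraph induced by a vertex set $S$. For a coloring $\mathcal{X}=(x_i)_{i\in V}\in\{0,1\}^V$ and $\beta\in(0,1]$, the Tolerant Balance Count is $$\hat\Phi(G,\beta,\mathcal{X})=|E^+\cup E^-|-\frac1\beta\sum_{(i,j)\in E^+}\mathbf 1\{x_i\ne x_j\}-\frac1\beta\sum_{(i,j)\in E^-}\mathbf 1\{x_i=x_j\}.$$ Algorithm $\mathtt{Search}(G,\beta,s,p,T)$, with $p\in(0,1)$, $T$ a positive integer and $s\in V$. It maintains a set $S$ of colored vertices (pairs $(x,c)$, $x\in V$, $c\in\{0,1\}$, each vertex occurring at most once; $|S|$ is the number of its vertices). The value of $S$ is $\hat\Phi$ of the subgraph induced by the vertices of $S$ with the coloring stored in $S$. The gain of an operation is the change it causes in this value. The operations are: VertexInsert$(x,c)$ (add $(x,c)$ to $S$, for $x\notin S$ adjacent to $S$), VertexDelete$(x)$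 (remove $x$ from $S$, the remaining induced subgraph being required to stay connected), ColorFlip$(x)$ (replace the color of $x\in S$ by the opposite one). Initially $S=\{(s,0)\}$, $\hat\Phi_{opt}=\hat\Phi_{cur}=0$, and a counter $\tau=T$. Two max-heaps keyed by gain are maintained: $MH_I$ holding all insertions $(v,c)$ with $v\notin S$ adjacent to $S$ and $c\in\{0,1\}$, and $MH_F$ holding the color flips of all vertices of $S$. While $\tau\ge 0$ and $|S|<|V|$, do one iteration: 1. let $op$ be the maximum-gain operation of $MH_I$; 2. with probability $p$, replace $op$ by the top operation of $MH_F$ if the latter has larger gain; 3. independently, with probability $\frac{p\log|S|}{|S|}$, call $\mathtt{DelEval}(S)$, which finds the maximum-gain deletion among vertices of $S$ whose removal keeps the subgraph connected (in time $O(\Delta|S|)$ using Tarjan's cut-vertex algorithm), and replace $op$ by it if it has larger gain; 4. execute $op$ on $S$, and for $x$ the vertex of $op$ update the entries of all $v\in N(x)\cup\{x\}$ in both heaps (each heap update costs $O(\log n)$); add the gain of $op$ to $\hat\Phi_{cur}$; 5. if $\hat\Phi_{cur}\le\hat\Phi_{opt}$, set $\tau\leftarrow\tau-1$; otherwise set $\hat\Phi_{opt}\leftarrow\hat\Phi_{cur}$ and $\tau\leftarrow\tau+T$. After the loop, the operations executed since the last update of $\hat\Phi_{opt}$ are undone, and $\overline H=G[S]$ and $\hat\Phi_{opt}$ are returned. Algorithm $\mathtt{Sampling}(G,\beta,\mathcal{C},p,T)$: start with $H=\emptyset$, best value $0$, and $TotalSize=0$. While $TotalSize<\mathcal{C}|V(G)|$: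 sample a uniformly random vertex $s\in V(G)$ (independently of the past), run $\mathtt{Search}(G,\beta,s,p,T)$ to get $\overline H$ and its value $\hat\Phi$; if $\hat\Phi$ exceeds the current best value, set the best value to $\hat\Phi$ and $H\leftarrow\overline H$; then $TotalSize\leftarrow TotalSize+|V(\overline H)|$. Return $H$. Conventions: $p$ and $T$ are fixed constants, and constants hidden in $O(\cdot)$ may depend on them. ''With high probability'' means with probability at least $1-n^{-c}$ for any fixed constant $c>0$ (hidden constants may depend on $c$). Running time is counted in the standard unit-cost model.
   Formalization: The bound uses max(Δ,1) for Δ and assumes n ≥ 2, since for an edgeless graph or n = 1 the stated bound is 0 while the running time is positive; Search also stops when no insertion is available (G disconnected), where step 1 is undefined. *)

(* Defs.v *)
From HB Require Import structures.
From mathcomp Require Import all_boot all_order all_algebra.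
From mathcomp Require Import all_classical all_reals all_analysis.

Set Implicit Arguments.
Unset Strict Implicit.
Unset Printing Implicit Defensive.

Import Order.TTheory GRing.Theory Num.Theory.
Local Open Scope ring_scope.

(* An edge is the two-element set of its endpoints. *)
Record sgraph (V : finType) := SGraph {
  pos_edges : {set {set V}};
  neg_edges : {set {set V}};
  edge_card2 : forall e, e \in pos_edges :|: neg_edges -> #|e| = 2%N;
  edges_disjoint : [disjoint pos_edges & neg_edges] }.

Section SignedGraph.
Variables (V : finType) (G : sgraph V).

Definition edges : {set {set V}} := pos_edges G :|: neg_edges G.

Definition adj : rel V := fun x y => [set x; y]%SET \in edges.

Definition nbrs (x : V) : {set V} := [set y | adj x y]%SET.

Definition max_degree : nat := \max_(x : V) #|nbrs x|.

Lemma induced_card2 (S : {set V}) (e : {set V}) :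
  e \in [set e in pos_edges G | e \subset S]%SET
        :|: [set e in neg_edges G | e \subset S]%SET -> #|e| = 2%N.
Proof.
rewrite !inE => /orP[] /andP[he _]; apply: (@edge_card2 _ G);
  by rewrite inE he ?orbT.
Qed.

Lemma induced_disjoint (S : {set V}) :
  [disjoint [set e in pos_edges G | e \subset S]%SET
          & [set e in neg_edges G | e \subset S]%SET].
Proof.
have := edges_disjoint G; rewrite -!setI_eq0 => /eqP h.
apply/eqP/setP => e; rewrite !inE.
have := congr1 (fun A : {set {set V}} => e \in A) h; rewrite !inE.
by case: (e \in pos_edges G); case: (e \in neg_edges G); rewrite ?andbF.
Qed.

(* G[S] keeps the ambient vertex type, so the vertices outside S become
   isolated; neither the balance count nor connectivity between vertices of S
   is affected by them. *)
Definition induced (S : {set V}) : sgraph V :=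
  SGraph (@induced_card2 S) (@induced_disjoint S).

End SignedGraph.

Definition connected_in (V : finType) (G : sgraph V) (S : {set V}) : bool :=
  (S != finset.set0) &&
  [forall u in S, forall v in S, connect (adj (induced G S)) u v].

Definition bichromatic (V : finType) (x : V -> bool) (e : {set V}) : bool :=
  [exists i in e, exists j in e, x i != x j].

(* Tolerant Balance Count. *)
Definition tbc (R : realType) (V : finType) (G : sgraph V) (beta : R)
    (x : V -> bool) : R :=
  #|edges G|%:R
  - beta^-1 * #|[set e in pos_edges G | bichromatic x e]%SET|%:R
  - beta^-1 * #|[set e in neg_edges G | ~~ bichromatic x e]%SET|%:R.

(* The set S of coloured vertices: [st x = Some c] iff (x, c) is in S. *)
Definition pcol (V : finType) := {ffun V -> option bool}.

Definition dom (V : finType) (st : pcol V) : {set V} :=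
  [set x | isSome (st x)]%SET.

Definition color (V : finType) (st : pcol V) : V -> bool :=
  fun x => odflt false (st x).

Inductive op (V : Type) : Type :=
  | VertexInsert of V & bool
  | VertexDelete of V
  | ColorFlip of V.

Definition op_vertex (V : Type) (o : op V) : V :=
  match o with VertexInsert x _ => x | VertexDelete x => x | ColorFlip x => x end.

Definition exec (V : finType) (st : pcol V) (o : op V) : pcol V :=
  [ffun y => if y == op_vertex o then
               match o with
               | VertexInsert _ c => Some c
               | VertexDelete _ => None
               | ColorFlip _ => omap negb (st y)
               end
             else st y].

(* Histories of executed operations are listed most recent first. *)
Definition history (V : finType) := seq (op V).

(* A tie-breaking rule: given the start vertex, the operations executed so far
   in the run (which determine the layout of the heaps) and the list of the tied
   maximum-gain operations, the index (modulo the length) of the one selected. *)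
Definition tie_break (V : finType) := V -> history V -> seq (op V) -> nat.

(* Costs of the primitives: an elementary step, the update in both heaps of the
   entries of a vertex (given the start vertex and the history of the run), and
   a call of DelEval on S. *)
Record costs (R : realType) (V : finType) := Costs {
  elem_cost : R;
  heap_cost : V -> history V -> V -> R;
  deleval_cost : pcol V -> R }.

(* The bounds O(1), O(log n) and O(Delta |S|), with hidden constant A.  The lower
   bound 1 makes every iteration of a loop cost at least one unit of time. *)
Definition costs_bounded (R : realType) (V : finType) (G : sgraph V) (A : R)
    (k : costs R V) : Prop :=
  [/\ 1 <= elem_cost k <= A,
      forall s h v, 0 <= heap_cost k s h v <= A * ln #|V|%:R &
      forall st, 0 <= deleval_cost k st
                 <= A * (max_degree G)%:R * #|dom st|%:R].

Record config (R : realType) (V : finType) := Config {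
  cur_set : pcol V;        (* S *)
  cur_val : R;             (* Phi_cur *)
  opt_val : R;             (* Phi_opt *)
  counter : int;           (* tau *)
  hist : history V;
  opt_set : pcol V;        (* S at the last update of Phi_opt *)
  pending : nat }.         (* operations executed since that update *)

Section Search.
Variables (R : realType) (V : finType) (G : sgraph V) (beta p : R) (T : nat).
Variables (tb : tie_break V) (k : costs R V).

Definition value (st : pcol V) : R :=
  tbc (induced G (dom st)) beta (color st).

Definition gain (st : pcol V) (o : op V) : R := value (exec st o) - value st.

Definition insertions (st : pcol V) : seq (op V) :=
  [seq VertexInsert x c
  | x <- enum [set x | (x \notin dom st) && [exists y in dom st, adj G x y]]%SET,
    c <- [:: false; true]].

Definition flips (st : pcol V) : seq (op V) :=
  [seq ColorFlip x | x <- enum (dom st)].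

Definition deletions (st : pcol V) : seq (op V) :=
  [seq VertexDelete x
  | x <- enum [set x in dom st | connected_in G (dom st :\ x)%SET]%SET].

(* One run of Search: the start vertex s, and, for the t-th iteration, the coin
   [coin t] of step 2 and the number [u t] in [0, 1] which decides step 3. *)
Section Run.
Variables (s : V) (coin : nat -> bool) (u : nat -> R).

Definition top (c : config R V) (l : seq (op V)) : option (op V) :=
  let maxs := [seq o <- l | all (fun o' => gain (cur_set c) o'
                                           <= gain (cur_set c) o) l] in
  onth maxs (tb s (hist c) maxs %% size maxs).

Definition replace_if_larger (c : config R V) (o o' : option (op V)) :=
  match o, o' with
  | Some a, Some b =>
      if gain (cur_set c) a < gain (cur_set c) b then Some b else Some a
  | _, _ => o
  end.

Definition calls_deleval (t : nat) (c : config R V) : bool :=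
  u t < p * ln #|dom (cur_set c)|%:R / #|dom (cur_set c)|%:R.

Definition selected (t : nat) (c : config R V) : option (op V) :=
  let o1 := top c (insertions (cur_set c)) in
  let o2 := if coin t then replace_if_larger c o1 (top c (flips (cur_set c)))
            else o1 in
  if calls_deleval t c
  then replace_if_larger c o2 (top c (deletions (cur_set c))) else o2.

Definition init_config : config R V :=
  let st := [ffun y => if y == s then Some false else None] in
  Config st 0 0 T%:Z [::] st 0.

(* The loop condition.  The last conjunct is implied by the second one when G is
   connected; without connectivity, the loop also ends when MH_I is empty, that
   is, when there is no operation to start from in step 1. *)
Definition running (c : config R V) : bool :=
  [&& 0 <= counter c, (#|dom (cur_set c)| < #|V|)%N &
      ~~ nilp (insertions (cur_set c))].

Definition step (t : nat) (c : config R V) : config R V :=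
  if selected t c is Some o then
    let st := exec (cur_set c) o in
    let v := cur_val c + gain (cur_set c) o in
    if v <= opt_val c
    then Config st v (opt_val c) (counter c - 1) (o :: hist c)
                (opt_set c) (pending c).+1
    else Config st v v (counter c + T%:Z) (o :: hist c) st 0
  else c.

Fixpoint config_at (t : nat) : config R V :=
  if t is t'.+1 then
    let c := config_at t' in if running c then step t' c else c
  else init_config.

(* [config_at] is constant from the end of the loop on, so that any time at which
   the loop has ended gives the same configuration. *)
Definition end_config : config R V :=
  config_at (xget 0%N [set t | ~~ running (config_at t)]%classic).

(* The returned subgraph is [induced G search_set]. *)
Definition search_set : {set V} := dom (opt_set end_config).
Definition search_val : R := opt_val end_config.

Definition update_cost (h : history V) (x : V) : R :=
  \sum_(v in x |: nbrs G x) heap_cost k s h v.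

Definition iteration_cost (t : nat) (c : config R V) : R :=
  elem_cost k
  + (if calls_deleval t c then deleval_cost k (cur_set c) else 0)
  + (if selected t c is Some o then update_cost (o :: hist c) (op_vertex o)
     else 0).

(* Initialisation, iterations of the loop, undoing of the pending operations,
   and output of G[S]. *)
Definition search_time : \bar R :=
  ((elem_cost k + update_cost [::] s)%:E
   + \sum_(0 <= t <oo)
       (if running (config_at t) then iteration_cost t (config_at t) else 0)%:E
   + (elem_cost k * (pending end_config)%:R
      + elem_cost k * \sum_(x in search_set) (#|nbrs G x|.+1)%:R)%:E)%E.

End Run.
End Search.

(* The random choices: [t_vertex i] is the start vertex of the i-th run of
   Search, [t_coin i] and [t_unif i] are the random sources of this run. *)
Record tape (R : realType) (V : finType) := Tape {
  t_vertex : nat -> V;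
  t_coin : nat -> nat -> bool;
  t_unif : nat -> nat -> R }.

Record sampling_state (R : realType) (V : finType) := SamplingState {
  best_set : {set V};
  best_val : R;
  total_size : nat }.

Section Sampling.
Variables (R : realType) (V : finType) (G : sgraph V) (beta C p : R) (T : nat).
Variables (tb : tie_break V) (k : costs R V) (w : tape R V).

Definition sampling_continues (a : sampling_state R V) : bool :=
  (total_size a)%:R < C * #|V|%:R.

Definition sampling_step (i : nat) (a : sampling_state R V) :
    sampling_state R V :=
  let S := search_set G beta p T tb (t_vertex w i) (t_coin w i) (t_unif w i) in
  let v := search_val G beta p T tb (t_vertex w i) (t_coin w i) (t_unif w i) in
  if best_val a < v then SamplingState S v (total_size a + #|S|)
  else SamplingState (best_set a) (best_val a) (total_size a + #|S|).

Fixpoint sampling_at (i : nat) : sampling_state R V :=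
  if i is i'.+1 then
    let a := sampling_at i' in
    if sampling_continues a then sampling_step i' a else a
  else SamplingState finset.set0 0 0.

Definition sampling_time : \bar R :=
  (\sum_(0 <= i <oo)
     (if sampling_continues (sampling_at i)
      then (elem_cost k)%:E
           + search_time G beta p T tb k
               (t_vertex w i) (t_coin w i) (t_unif w i)
      else 0))%E.

End Sampling.

Section Probability.
Context {d : measure_display} {Omega : measurableType d} {R : realType}.
Variable P : probability Omega R.

Definition mutually_independent (I : eqType) (F : I -> set (set Omega)) : Prop :=
  forall (r : seq I) (B : I -> set Omega), uniq r ->
    (forall i, i \in r -> F i (B i)) ->
    P (\big[setI/setT]_(i <- r) B i) = (\prod_(i <- r) P (B i))%E.

Definition cond_expectation (E : set Omega) (f : Omega -> \bar R) : \bar R :=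
  ((\int[P]_(x in E) f x) * ((fine (P E))^-1)%:E)%E.

Variables (V : finType) (p : R) (w : Omega -> tape R V).

(* The three summands index the start vertices, the coins and the uniform
   numbers; each source comes with the sigma-algebra it generates. *)
Definition source_events (i : nat + (nat * nat) + (nat * nat)) :
    set (set Omega) :=
  match i with
  | inl (inl i) =>
      [set (fun x => t_vertex (w x) i) @^-1` B | B in [set: set V]]%classic
  | inl (inr (i, t)) =>
      [set (fun x => t_coin (w x) i t) @^-1` B | B in [set: set bool]]%classic
  | inr (i, t) =>
      [set (fun x => t_unif (w x) i t) @^-1` B
      | B in [set B : set R | measurable B]]%classic
  end.

Definition random_tape : Prop :=
  [/\ forall i B, source_events i B -> measurable B,
      forall i v, P [set x | t_vertex (w x) i = v]%classic
                  = (#|V|%:R^-1)%:E,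
      forall i t, P [set x | t_coin (w x) i t]%classic = p%:E,
      forall i t a, 0 <= a <= 1 ->
        P [set x | t_unif (w x) i t < a]%classic = a%:E &
      mutually_independent source_events].

End Probability.

(* Main.v *)
Require Import Defs.
From mathcomp Require Import all_boot all_order all_algebra.
From mathcomp Require Import all_classical all_reals all_analysis.
From HB Require Import structures.
From mathcomp Require Import measurable_realfun zify ring lra.

(* The bound holds for the unconditional expectation, so that the event E is the
   whole space.

   Let X_t be the size of S after t iterations of one run.  A coin and a call of
   DelEval can only turn an insertion into something else with probabilities p
   and p ln X / X, so for a suitable f with f(x) >= 2^-x the mean of f(X_t) decays
   like (1 - e)^t.  Since t <= B X_t + (1/e) (1 + e)^t f(X_t) for every t, the
   last improving iteration t* satisfies E[t*] = O(E|S_opt|), although t* is not a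
   stopping time.  The counter gives at most (T + 1)(t* + 1) iterations, and one
   iteration costs O(Delta log n) in mean given the past, the call of DelEval
   included.  Hence a run costs O(Delta log n) E|S_opt| in mean, also given the
   previous runs, and the sizes |S_opt| add up to at most (C + 1) n.

   All runs stop after a deterministic number of steps, because Phi_opt takes
   finitely many values, and the uniform numbers matter only through finitely
   many comparisons.  The expectation is therefore a finite sum over a product
   space, and conditioning on the past amounts to resampling one coordinate. *)

Set Implicit Arguments.
Unset Strict Implicit.
Unset Printing Implicit Defensive.

Import Order.TTheory GRing.Theory Num.Theory.
Local Open Scope ring_scope.

(** Classical equality, so that membership in a list of operations makes sense. *)
HB.instance Definition _ (V : Type) := gen_eqMixin (op V).

(** * Effect of one operation on the size of S *)

Section Moves.
Variables (V : finType) (G : sgraph V) (st : pcol V).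

Lemma card_dom_insert (o : op V) :
  o \in insertions G st -> #|dom (exec st o)| = #|dom st|.+1.
Proof.
case/allpairsP=> -[x b] /= []; rewrite mem_enum inE => /andP[xS _] _ ->.
have -> : dom (exec st (VertexInsert x b)) = (x |: dom st)%SET.
  by apply/setP => y; rewrite !inE ffunE /=; case: eqP.
by rewrite cardsU1 xS.
Qed.

Lemma card_dom_flip (o : op V) :
  o \in flips st -> #|dom (exec st o)| = #|dom st|.
Proof.
case/mapP => x; rewrite mem_enum => xS ->; congr #|pred_of_set _|.
by apply/setP => y; rewrite !inE ffunE /=; case: eqP; case: (st y).
Qed.

Lemma card_dom_delete (o : op V) :
  o \in deletions G st -> #|dom st| = #|dom (exec st o)|.+1 /\
                          (0 < #|dom (exec st o)|)%N.
Proof.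
case/mapP => x; rewrite mem_enum inE => /andP[xS /andP[nz _]] ->.
have -> : dom (exec st (VertexDelete x)) = (dom st :\ x)%SET.
  by apply/setP => y; rewrite !inE ffunE /=; case: eqP.
by rewrite card_gt0 nz (cardsD1 x) xS.
Qed.

End Moves.

(** * The selected operation and the size change in one iteration *)

Section Step.
Variables (R : realType) (V : finType) (G : sgraph V) (beta p : R) (T : nat).
Variables (tb : tie_break V) (s : V) (coin : nat -> bool) (u : nat -> R).

Local Notation top := (top G beta tb s).
Local Notation selected := (selected G beta p tb s coin u).
Local Notation calls := (calls_deleval p u).
Local Notation running := (running G).
Local Notation step := (step G beta p T tb s coin u).

Lemma top_mem (c : config R V) l o : top c l = Some o -> o \in l.
Proof.
rewrite /top; set maxs := seq.filter _ _ => h.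
have : o \in maxs by apply/onthP; eexists; exact: h.
by rewrite mem_filter => /andP[].
Qed.

(** A nonempty finite list has a maximiser of the gain, so the list of ties is nonempty and an index
    modulo its length is in range. *)
Lemma top_neq_nil (c : config R V) l : ~~ nilp l -> top c l != None.
Proof.
case: l => // a l _; rewrite /top.
set maxs := seq.filter _ _.
suff sz : (0 < size maxs)%N.
  by have := onthTE maxs (tb s (hist c) maxs %% size maxs); rewrite ltn_pmod //;
    case: onth.
rewrite size_filter -has_count; apply/hasP.
pose g := gain G beta (cur_set c).
have [i _ imax] := @arg_maxP _ _ _ (@ord0 (size l)) xpredT
  (fun i : 'I_(size (a :: l)) => g (nth a (a :: l) i)) isT.
exists (nth a (a :: l) i); first exact: mem_nth.
apply/allP => o /(nthP a)[j jl <-].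
exact: (imax (Ordinal jl)).
Qed.

Lemma replaced_cases (c : config R V) o o' b :
  replace_if_larger G beta c o o' = Some b -> o = Some b \/ o' = Some b.
Proof.
rewrite /replace_if_larger; case: o => [a|//]; case: o' => [a'|]; last by left.
by case: ifP => _ [<-]; [right|left].
Qed.

Lemma replaced_neq_nil (c : config R V) o o' :
  o != None -> replace_if_larger G beta c o o' != None.
Proof. by case: o => // a _; case: o' => //= b; case: ifP. Qed.

Lemma selected_neq_nil t (c : config R V) : running c -> selected t c != None.
Proof.
case/and3P => _ _ /(top_neq_nil c) hI; rewrite /selected.
by do 2![case: ifP => _]; rewrite ?replaced_neq_nil.
Qed.

Lemma selected_mem t (c : config R V) o : selected t c = Some o ->
  [\/ o \in insertions G (cur_set c),
      coin t /\ o \in flips (cur_set c) |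
      calls t c /\ o \in deletions G (cur_set c)].
Proof.
rewrite /selected; set o2 := (if coin t then _ else _) => h.
have: o2 = Some o \/ calls t c /\ o \in deletions G (cur_set c).
  move: h; case: ifP => [_ /replaced_cases[|/top_mem]|_]; by [left|right].
case=> [|h3]; last by constructor 3.
rewrite /o2; case: ifP => [_ /replaced_cases[|]|_] /top_mem;
  by [constructor 1|constructor 2].
Qed.

(** Only a call of [DelEval] can shrink S, and by one vertex; without coin and call the insertion of
    step 1 is kept. A deletion never empties S, because [connected_in] excludes the empty set. *)
Lemma step_size t (c : config R V) : running c ->
  [/\ (#|dom (cur_set (step t c))| <= #|dom (cur_set c)|.+1)%N,
      (#|dom (cur_set c)| <= #|dom (cur_set (step t c))| + calls t c)%N,
      (0 < #|dom (cur_set c)|)%N -> (0 < #|dom (cur_set (step t c))|)%N &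
      ~~ coin t -> ~~ calls t c ->
      #|dom (cur_set (step t c))| = #|dom (cur_set c)|.+1].
Proof.
move=> /(selected_neq_nil t); case E : (selected t c) => [a|//] _.
have -> : cur_set (step t c) = exec (cur_set c) a.
  by rewrite /Defs.step E; case: ifP.
case: (selected_mem E) => [/card_dom_insert ->|[ct /card_dom_flip ->]|[cl
  /card_dom_delete[-> h]]].
- by split=> //; lia.
- by rewrite ct leqnSn leq_addr.
- by rewrite cl addn1; split=> //; lia.
Qed.

End Step.

(** * Trajectory of one run: termination and the last improvement *)

Section Run.
Variables (R : realType) (V : finType) (G : sgraph V) (beta p : R) (T : nat).
Variables (tb : tie_break V) (s : V) (coin : nat -> bool) (u : nat -> R).

Local Notation run := (running G).
Local Notation cfg := (config_at G beta p T tb s coin u).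
Local Notation val0 := (value G beta (cur_set (init_config R T s))).
Local Notation size_at t := #|dom (cur_set (cfg t))|.

(** The counter starts at T, gains T at an improvement and loses 1 otherwise; with at most
    [#|pcol V|] improvements, the loop has ended by this time. *)
Definition max_steps : nat := (T + T.+1 * #|{: pcol V}|).+1.

(** Configuration t was actually reached. Unlike [running], this includes the configuration in which
    the loop ends, which may be that of the last improvement. *)
Definition live (t : nat) : bool := if t is t'.+1 then run (cfg t') else true.

Lemma config_at_stop a b : ~~ run (cfg a) -> (a <= b)%N -> cfg b = cfg a.
Proof.
move=> ra; elim: b => [|b IH]; first by rewrite leqn0 => /eqP ->.
rewrite leq_eqVlt => /orP[/eqP -> //|]; rewrite ltnS => /IH /= ->.
by rewrite (negbTE ra).
Qed.

Lemma running_pred t : run (cfg t.+1) -> run (cfg t).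
Proof. by apply: contraTT => nr; rewrite (config_at_stop nr). Qed.

Lemma hist_size_running t : run (cfg t) -> size (hist (cfg t)) = t.
Proof.
elim: t => // t IH /running_pred rt; rewrite /= rt /step.
have := selected_neq_nil beta p tb s coin u t rt.
by case: selected => // a _; case: ifP => _ /=; rewrite IH.
Qed.

Lemma hist_size t : size (hist (cfg t)) = (\sum_(j < t) run (cfg j))%N.
Proof.
elim: t => [|t IH]; first by rewrite big_ord0.
rewrite big_ord_recr /= -IH; case: ifP => rt; last by rewrite addn0.
have := selected_neq_nil beta p tb s coin u t rt; rewrite /step.
by case: selected => // a _; case: ifP => _ /=; rewrite addn1.
Qed.

Lemma dom_init : #|dom (cur_set (init_config R T s))| = 1%N.
Proof.
rewrite -(cards1 s); congr #|pred_of_set _|.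
by apply/setP => y; rewrite !inE ffunE; case: eqP.
Qed.

Lemma dom_gt0 t : (0 < size_at t)%N /\ (0 < #|dom (opt_set (cfg t))|)%N.
Proof.
elim: t => [|t [IH1 IH2]]; first by rewrite dom_init.
rewrite [cfg t.+1]/=; case: ifP => // rt.
have [_ _ /(_ IH1) h _] := step_size beta p T tb s coin u t rt.
split=> //; move: h; rewrite /step.
by case: selected => // a; case: ifP.
Qed.

Let rank (a : R) : nat := #|[set st : pcol V | value G beta st - val0 <= a]%SET|.

(* An improving iteration strictly raises [Phi_opt], which is up to a constant
   the value of a colouring: there are at most [#|pcol V|] of them. *)
Lemma counter_inv t : let c := cfg t in
  cur_val c = value G beta (cur_set c) - val0 /\ -1 <= counter c /\
  exists k : nat,
    [/\ counter c + (size (hist c))%:Z = (T + T.+1 * k)%N%:Z,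
        (k + pending c <= size (hist c))%N &
        (k <= rank (opt_val c))%N].
Proof.
(* The witness [k] counts the improvements: each raises the counter plus the number of executed
   operations by T + 1, while any other iteration preserves this sum. *)
elim: t => [|t /= [IH1 [IH2 [k [k1 k2 k3]]]]].
  by split; [rewrite /= subrr|split => //; exists 0%N; split=> //=; lia].
case: ifP => rt; last by split=> //; split=> //; exists k.
have := selected_neq_nil beta p tb s coin u t rt; rewrite /step.
have /and3P[c0 _ _] := rt.
case: selected => // a _.
have -> : cur_val (cfg t) + gain G beta (cur_set (cfg t)) a
          = value G beta (exec (cur_set (cfg t)) a) - val0.
  by rewrite IH1 /gain; ring.
case: ifP => /= imp; (split; first by []).
  by split; [|exists k; split=> //]; lia.
split; first by lia.
exists k.+1; split; [lia|lia|].
(* The colouring just reached has its shifted value equal to the new [Phi_opt] and above the old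
   one, so [rank] grows strictly. *)
apply: (leq_ltn_trans k3); apply: proper_card; apply/properP; split.
  apply/fintype.subsetP => st; rewrite !inE => /le_trans; apply.
  by rewrite ltW // ltNge imp.
by exists (exec (cur_set (cfg t)) a); rewrite !inE ?imp.
Qed.

Lemma not_running_max_steps : ~~ run (cfg max_steps).
Proof.
apply/negP => rM; have [_ [_ [k [k1 _ k3]]]] := counter_inv max_steps.
have /and3P[c0 _ _] := rM; move: k1; rewrite (hist_size_running rM).
have : (T.+1 * k <= T.+1 * #|{: pcol V}|)%N.
  by rewrite leq_mul2l (leq_trans k3) // max_card.
have : max_steps = (T + T.+1 * #|{: pcol V}|).+1 by []; lia.
Qed.

(** The time picked by [xget] is arbitrary, but configurations are constant once the loop has
    ended. *)
Lemma end_configE : end_config G beta p T tb s coin u = cfg max_steps.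
Proof.
rewrite /end_config; set m := xget _ _.
have rm : ~~ run (cfg m).
  by apply: (@xgetPex _ 0%N [set t | ~~ run (cfg t)]%classic); exists max_steps;
     exact: not_running_max_steps.
have [h|h] := leqP m max_steps; first by rewrite (config_at_stop rm).
by rewrite (config_at_stop not_running_max_steps) // ltnW.
Qed.

Lemma pending_le_hist t : (pending (cfg t) <= size (hist (cfg t)))%N.
Proof. have [_ [_ [k [_ h _]]]] := counter_inv t; lia. Qed.

(** The difference of [size hist] and [pending] is the time of the last improvement, which bounds
    the number of improvements; the counter stays at least -1. *)
Lemma hist_size_le t :
  (size (hist (cfg t)) <= T.+1 * (size (hist (cfg t)) - pending (cfg t)).+1)%N.
Proof. have [_ [h0 [k [h1 h2 _]]]] := counter_inv t; nia. Qed.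

(** At the last improvement the current set is [opt_set], so [FB] applies with that time and size.
    As that time is random and not a stopping time, its term is bounded by the sum over all reached
    configurations, which can be averaged one by one. *)
Lemma last_improvement_le (B : R) (F : nat -> nat -> R) t :
    (forall j x, 0 <= F j x) -> (forall j x, j%:R <= B * x%:R + F j x) ->
  (size (hist (cfg t)) - pending (cfg t))%:R <=
  B * #|dom (opt_set (cfg t))|%:R
  + \sum_(j < t.+1) (live j)%:R * F j (size_at j).
Proof.
move=> F0 FB; elim: t => [|t IH].
  by rewrite big_ord1 mul1r FB.
have -> : \sum_(j < t.+2) (live j)%:R * F j (size_at j) =
    \sum_(j < t.+1) (live j)%:R * F j (size_at j)
    + (run (cfg t))%:R * F t.+1 (size_at t.+1) by rewrite big_ord_recr.
have cS : cfg t.+1 = if run (cfg t) then step G beta p T tb s coin u t (cfg t) else cfg t.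
  by [].
case: ifP cS => rt cS; last by rewrite cS mul0r addr0.
have ht := hist_size_running rt; have hp := pending_le_hist t.
(* An improving iteration makes the current set optimal and moves the last improvement to [t.+1];
   any other iteration changes neither. *)
have : cur_set (cfg t.+1) = opt_set (cfg t.+1) /\ pending (cfg t.+1) = 0%N /\
    size (hist (cfg t.+1)) = t.+1 \/
    opt_set (cfg t.+1) = opt_set (cfg t) /\
    (size (hist (cfg t.+1)) - pending (cfg t.+1) =
     size (hist (cfg t)) - pending (cfg t))%N.
  have := selected_neq_nil beta p tb s coin u t rt; rewrite cS /step.
  by case: selected => // a _; case: ifP => _ /=; [right|left]; rewrite ?subSS ?ht.
case=> [[<- [-> ->]]|[-> ->]].
  rewrite subn0 mul1r addrCA ler_wpDl //.
  by apply: sumr_ge0 => i _; rewrite mulr_ge0.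
by rewrite (le_trans IH) // mul1r addrA lerDl.
Qed.

End Run.

(** * Dependence of a run on finitely many random choices *)

Section Agreement.
Variables (R : realType) (V : finType) (G : sgraph V) (beta p : R) (T : nat).
Variables (tb : tie_break V) (k : costs R V) (s : V).

(* The numbers [u t] matter only through the tests of [calls_deleval]. *)
Definition agree (m : nat) (coin coin' : nat -> bool) (u u' : nat -> R) : Prop :=
  forall t, (t < m)%N -> coin t = coin' t /\
    forall x, (x <= #|V|)%N ->
      (u t < p * ln x%:R / x%:R) = (u' t < p * ln x%:R / x%:R).

Variables (m : nat) (coin coin' : nat -> bool) (u u' : nat -> R).
Hypothesis ag : agree m coin coin' u u'.

Lemma calls_agree t (c : config R V) : (t < m)%N ->
  calls_deleval p u t c = calls_deleval p u' t c.
Proof. by move=> /ag[_ h]; rewrite /calls_deleval h // max_card. Qed.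

Lemma selected_agree t (c : config R V) : (t < m)%N ->
  selected G beta p tb s coin u t c = selected G beta p tb s coin' u' t c.
Proof.
by move=> tm; have [h _] := ag tm; rewrite /selected (calls_agree _ tm) h.
Qed.

Lemma config_at_agree t : (t <= m)%N ->
  config_at G beta p T tb s coin u t = config_at G beta p T tb s coin' u' t.
Proof.
elim: t => // t IH tm; rewrite /= IH 1?ltnW //.
by rewrite /step (selected_agree _ tm).
Qed.

Lemma iteration_cost_agree t (c : config R V) : (t < m)%N ->
  iteration_cost G beta p tb k s coin u t c =
  iteration_cost G beta p tb k s coin' u' t c.
Proof.
by move=> tm; rewrite /iteration_cost (selected_agree _ tm) (calls_agree _ tm).
Qed.

End Agreement.

(** * Pathwise bounds on the cost of one run *)

Section Cost.
Variables (R : realType) (V : finType) (G : sgraph V) (beta p : R) (T : nat).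
Variables (tb : tie_break V) (k : costs R V) (A : R).
Hypothesis kA : costs_bounded G A k.
Hypothesis V1 : (1 < #|V|)%N.

Local Notation Delta := (maxn 1 (max_degree G)).
Local Notation logn := (ln #|V|%:R : R).

(** Lets constants be absorbed into ln n; ln 2 >= 1/2 comes from ln (1 + x) <= x at x = -1/2. *)
Lemma ln_card_ge : 1 <= 2 * logn.
Proof.
have le2 : ln 2 <= logn by rewrite ler_ln ?posrE ?ltr0n ?ler_nat // ltnW.
suff : 1 / 2 <= ln (2 : R) by lra.
have := @le_ln1Dx R (- (1 / 2)) ltac:(lra).
have -> : 1 + - (1 / 2) = (2 : R)^-1 by field.
by rewrite lnV ?posrE //; lra.
Qed.

Lemma cost_const_ge1 : 1 <= A.
Proof. by have [/andP[h1 h2] _ _] := kA; exact: le_trans h2. Qed.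

Lemma card_nbrs_le x : (#|nbrs G x| <= Delta)%N.
Proof. by rewrite leq_max leq_bigmax orbT. Qed.

Lemma update_cost_bounds s h x :
  0 <= update_cost G k s h x <= 2 * A * Delta%:R * logn.
Proof.
have [_ hk _] := kA; have A1 := cost_const_ge1; have l1 := ln_card_ge.
apply/andP; split; first by apply: sumr_ge0 => i _; case/andP: (hk s h i).
rewrite /update_cost (@le_trans _ _ (\sum_(v in x |: nbrs G x) A * logn)) //.
  by apply: ler_sum => v _; case/andP: (hk s h v).
rewrite sumr_const -[leLHS]mulr_natl.
have -> : 2 * A * Delta%:R * logn = (2 * Delta)%N%:R * (A * logn).
  by rewrite natrM; ring.
apply: ler_wpM2r; first by nra.
rewrite ler_nat cardsU1; have := card_nbrs_le x.
by have := leq_maxl 1 (max_degree G); case: (_ \notin _); lia.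
Qed.

(** The call of [DelEval] is kept apart: its cost grows with |S| and becomes small only after
    averaging over the test of step 3. *)
Lemma iteration_cost_bounds s coin u t (c : config R V) :
  0 <= iteration_cost G beta p tb k s coin u t c <=
  4 * A * Delta%:R * logn
  + A * Delta%:R * ((calls_deleval p u t c)%:R * #|dom (cur_set c)|%:R).
Proof.
have [/andP[e1 eA] _ hd] := kA; have A1 := cost_const_ge1; have l1 := ln_card_ge.
have D1 : 1 <= Delta%:R :> R by rewrite ler1n leq_maxl.
have Al : A <= 2 * A * Delta%:R * logn.
  have : 1 * 1 <= Delta%:R * (2 * logn) by apply: ler_pM.
  by nra.
rewrite /iteration_cost.
set x1 := (if calls_deleval _ _ _ _ then _ else _).
set x2 := (if selected _ _ _ _ _ _ _ _ _ is Some _ then _ else _).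
have /andP[h1 h1'] : 0 <= x1 <=
    A * Delta%:R * ((calls_deleval p u t c)%:R * #|dom (cur_set c)|%:R).
  rewrite /x1; case: ifP => _; last by rewrite mul0r mulr0 lexx.
  case/andP: (hd (cur_set c)) => -> /= /le_trans; apply.
  rewrite mul1r ler_wpM2r // ler_wpM2l ?ler_nat ?leq_maxr //; lra.
have /andP[h2 h2'] : 0 <= x2 <= 2 * A * Delta%:R * logn.
  rewrite /x2; case: selected => [a|]; first exact: update_cost_bounds.
  by rewrite lexx /=; lra.
apply/andP; split; lra.
Qed.

Section OneRun.
Variables (s : V) (coin : nat -> bool) (u : nat -> R).
Local Notation cfg := (config_at G beta p T tb s coin u).
Local Notation M := (max_steps V T).

Definition search_cost : R :=
  elem_cost k + update_cost G k s [::] s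
  + \sum_(t < M) (if running G (cfg t)
                  then iteration_cost G beta p tb k s coin u t (cfg t) else 0)
  + (elem_cost k * (pending (cfg M))%:R
     + elem_cost k * \sum_(x in dom (opt_set (cfg M))) (#|nbrs G x|.+1)%:R).

Lemma search_timeE :
  search_time G beta p T tb k s coin u = search_cost%:E.
Proof.
rewrite /search_time /search_set end_configE /search_cost !EFinD.
congr (_ + _ + _)%E.
rewrite (@nneseries_split _ _ 0 M) => [|t _]; last first.
  by rewrite lee_fin; case: ifP => // _;
    case/andP: (iteration_cost_bounds s coin u t (cfg t)).
rewrite add0n eseries0 ?adde0 => [|t Mt _].
  by rewrite big_mkord -sumEFin.
have nr := not_running_max_steps G beta p T tb s coin u.
by rewrite (config_at_stop nr Mt) (negbTE nr).
Qed.

Lemma search_cost_ge0 : 0 <= search_cost.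
Proof.
have [/andP[e1 eA] _ _] := kA.
have /andP[h _] := update_cost_bounds s [::] s.
have e0 : 0 <= elem_cost k by lra.
apply: addr_ge0; [apply: addr_ge0; first exact: addr_ge0|apply: addr_ge0].
- apply: sumr_ge0 => t _; case: ifP => // _.
  by case/andP: (iteration_cost_bounds s coin u t (cfg t)).
- exact: mulr_ge0.
- by apply: mulr_ge0 => //; apply: sumr_ge0.
Qed.

(** The extra [elem_cost] is spent by the loop of [Sampling]. Since |S_opt| >= 1, the factor 10
    collects this step, the initialisation and the output; the factor 6 is 4 for the iterations
    without [DelEval] and 2 for undoing. *)
Lemma search_cost_le :
  elem_cost k + search_cost <=
  A * Delta%:R *
  (10 * logn * #|dom (opt_set (cfg M))|%:R
   + 6 * logn * (size (hist (cfg M)))%:R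
   + \sum_(t < M) (running G (cfg t))%:R *
       ((calls_deleval p u t (cfg t))%:R * #|dom (cur_set (cfg t))|%:R)).
Proof.
have [/andP[e1 eA] _ _] := kA; have A1 := cost_const_ge1; have l1 := ln_card_ge.
have D1 : 1 <= Delta%:R :> R by rewrite ler1n leq_maxl.
have AD1 : 1 <= A * Delta%:R by rewrite -[leLHS]mul1r ler_pM.
have X1 : 1 <= #|dom (opt_set (cfg M))|%:R :> R.
  by rewrite ler1n; case: (dom_gt0 G beta p T tb s coin u M).
have /andP[_ hu] := update_cost_bounds s [::] s.
have h1 : \sum_(t < M) (if running G (cfg t)
            then iteration_cost G beta p tb k s coin u t (cfg t) else 0)
   <= A * Delta%:R * (4 * logn * (size (hist (cfg M)))%:R
   + \sum_(t < M) (running G (cfg t))%:R *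
       ((calls_deleval p u t (cfg t))%:R * #|dom (cur_set (cfg t))|%:R)).
  rewrite hist_size natr_sum mulr_sumr -big_split mulr_sumr.
  apply: ler_sum => t _ /=; case: ifP => _; last by rewrite mulr0 mul0r addr0 mulr0.
  have /andP[_ h] := iteration_cost_bounds s coin u t (cfg t).
  by rewrite mulr1 mul1r; apply: (le_trans h); rewrite le_eqVlt; apply/orP; left;
    apply/eqP; ring.
have h2 : (pending (cfg M))%:R <= (size (hist (cfg M)))%:R :> R.
  by rewrite ler_nat pending_le_hist.
have h3 : \sum_(x in dom (opt_set (cfg M))) (#|nbrs G x|.+1)%:R <=
    2 * Delta%:R * #|dom (opt_set (cfg M))|%:R :> R.
  rewrite [leRHS]mulr_natr -sumr_const; apply: ler_sum => x _.
  rewrite -natrM ler_nat; have := card_nbrs_le x.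
  have := leq_maxl 1 (max_degree G); lia.
rewrite /search_cost.
set X := #|dom (opt_set _)|%:R in X1 h3 *; set N := (size _)%:R in h1 h2 *.
set Y := (\sum_(t < M) _ * _) in h1 *; set I := (\sum_(t < M) _) in h1 *.
set W := (\sum_(x in _) _) in h3 *.
have e2 : elem_cost k * (pending (cfg M))%:R <= A * Delta%:R * (2 * logn * N).
  apply: ler_pM => //; [lra|nra|apply: (le_trans h2)].
  by rewrite -[leLHS]mul1r ler_wpM2r.
have e3 : elem_cost k * W <= A * Delta%:R * (4 * logn * X).
  have : elem_cost k * W <= A * (2 * Delta%:R * X).
    by apply: ler_pM => //; [lra|exact: sumr_ge0].
  move=> /le_trans; apply.
  have -> : A * (2 * Delta%:R * X) = 1 * (2 * A * Delta%:R * X) by ring.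
  have -> : A * Delta%:R * (4 * logn * X) = (2 * logn) * (2 * A * Delta%:R * X) by ring.
  by apply: ler_wpM2r => //; nra.
have lX1 : 1 * 1 <= 2 * logn * X by apply: ler_pM.
have e4 : A <= A * Delta%:R * (2 * logn * X) by nra.
have e5 : 2 * A * Delta%:R * logn <= A * Delta%:R * (2 * logn * X).
  have -> : 2 * A * Delta%:R * logn = A * Delta%:R * (2 * logn * 1) by ring.
  by rewrite ler_wpM2l ?ler_wpM2l //; lra.
lra.
Qed.

End OneRun.
End Cost.

(** * Guard, total size and cost of Sampling along a tape *)

Section Sampling.
Variables (R : realType) (V : finType) (G : sgraph V) (beta C p : R) (T : nat).
Variables (tb : tie_break V) (k : costs R V) (A : R).
Hypothesis kA : costs_bounded G A k.
Hypothesis V1 : (1 < #|V|)%N.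

Local Notation M := (max_steps V T).
Local Notation state w i := (sampling_at G beta C p T tb w i).

Definition continues (w : tape R V) (i : nat) : bool :=
  sampling_continues C (state w i).

Definition run_config (w : tape R V) (i t : nat) : config R V :=
  config_at G beta p T tb (t_vertex w i) (t_coin w i) (t_unif w i) t.

Definition run_cost (w : tape R V) (i : nat) : R := elem_cost k +
  search_cost G beta p T tb k (t_vertex w i) (t_coin w i) (t_unif w i).

Definition final_size (w : tape R V) (i : nat) : nat :=
  #|dom (opt_set (run_config w i M))|.

Lemma search_cost_agree s coin coin' u u' : agree V p M coin coin' u u' ->
  search_cost G beta p T tb k s coin u = search_cost G beta p T tb k s coin' u'.
Proof.
move=> ag; rewrite /search_cost (config_at_agree G beta T tb s ag) //.
congr (_ + _ + _); apply: eq_bigr => t _.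
rewrite (config_at_agree G beta T tb s ag) 1?ltnW //.
by rewrite (iteration_cost_agree G beta tb k s ag).
Qed.

Definition tapes_agree (i : nat) (w w' : tape R V) : Prop :=
  forall j, (j < i)%N -> t_vertex w j = t_vertex w' j /\
    agree V p M (t_coin w j) (t_coin w' j) (t_unif w j) (t_unif w' j).

(** The state before run i is a function of the earlier runs; this is what allows averaging over run
    i with the past held fixed. *)
Lemma sampling_at_agree (w w' : tape R V) i :
  tapes_agree i w w' -> state w i = state w' i.
Proof.
elim: i => //= i IH ag; rewrite IH => [|j ji]; last exact/ag/ltnW.
have [ev ag'] := ag i (leqnn _).
by rewrite /sampling_step /search_set /search_val !end_configE ev
  (config_at_agree G beta T tb _ ag').
Qed.

Lemma run_cost_agree (w w' : tape R V) i :
  tapes_agree i.+1 w w' -> run_cost w i = run_cost w' i.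
Proof.
move=> ag; have [ev ag'] := ag i (leqnn _).
by rewrite /run_cost ev (search_cost_agree _ ag').
Qed.

Variable w : tape R V.

Lemma total_sizeS i : total_size (state w i.+1) =
  (total_size (state w i) + continues w i * final_size w i)%N.
Proof.
rewrite /= -/(continues w i); case: (continues w i); last by rewrite mul0n addn0.
by rewrite mul1n /sampling_step /search_set end_configE; case: ifP.
Qed.

Lemma total_sizeE i :
  total_size (state w i) = (\sum_(j < i) continues w j * final_size w j)%N.
Proof. by elim: i => [|i IH]; rewrite ?big_ord0 // total_sizeS IH big_ord_recr. Qed.

(** A run starts only while the total is below C n, and it adds at most n. *)
Lemma total_size_le (C0 : 0 < C) i :
  (total_size (state w i))%:R <= (C + 1) * #|V|%:R.
Proof.
elim: i => [|i IH]; first by rewrite mulr_ge0 //; lra.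
rewrite total_sizeS; case: (boolP (continues w i)) => ci; last by rewrite mul0n addn0.
rewrite mul1n natrD mulrDl mul1r; apply: lerD; last by rewrite ler_nat max_card.
exact: (ltW ci).
Qed.

Lemma continues_pred i : continues w i.+1 -> continues w i.
Proof.
apply: contraTT => nc; rewrite [X in ~~ X]/continues [state w _]/=.
by rewrite -/(continues w i) (negbTE nc).
Qed.

(** Every run returns at least one vertex; this gives a deterministic bound on the number of
    runs. *)
Lemma leq_total_size i : continues w i -> (i <= total_size (state w i))%N.
Proof.
elim: i => // i IH /continues_pred ci; rewrite total_sizeS ci mul1n.
have := IH ci; have [_] := dom_gt0 G beta p T tb (t_vertex w i) (t_coin w i) (t_unif w
  i) M.
rewrite /final_size /run_config; lia.
Qed.

Lemma not_continues i : C * #|V|%:R <= i%:R -> ~~ continues w i.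
Proof.
move=> Ci; apply/negP => ci; have := leq_total_size ci.
move: (ci); rewrite /continues /sampling_continues -(ler_nat R) => h1 h2.
by have := lt_le_trans h1 (le_trans Ci h2); rewrite ltxx.
Qed.

Definition sampling_cost (N : nat) : R :=
  \sum_(i < N) (continues w i)%:R * run_cost w i.

Lemma run_cost_ge0 i : 0 <= run_cost w i.
Proof.
have [/andP[e1 _] _ _] := kA; rewrite /run_cost addr_ge0 //; first by lra.
exact: (search_cost_ge0 beta p T tb kA V1).
Qed.

Lemma sampling_timeE N : C * #|V|%:R <= N%:R ->
  sampling_time G beta C p T tb k w = (sampling_cost N)%:E.
Proof.
move=> CN; rewrite /sampling_time.
transitivity (\sum_(0 <= i <oo) ((continues w i)%:R * run_cost w i)%:E)%E.
  apply: eq_eseriesr => i _; rewrite -/(continues w i) (search_timeE _ _ _ _ kA) //.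
  by case: continues; rewrite ?mul1r ?mul0r.
rewrite (@nneseries_split _ _ 0 N) => [|i _]; last first.
  by rewrite lee_fin mulr_ge0 // run_cost_ge0.
rewrite add0n eseries0 ?adde0 => [|i Ni _].
  by rewrite big_mkord -sumEFin.
by rewrite (negbTE (not_continues _)) ?mul0r // (le_trans CN) // ler_nat.
Qed.

End Sampling.

(** * A potential for the size of S, with the estimates it rests on *)

Lemma ln_le_self (R : realType) (x : R) : 0 < x -> ln x <= x.
Proof.
move=> x0; have := @le_ln1Dx R (x - 1) ltac:(lra).
by rewrite addrCA subrr addr0; lra.
Qed.

(** With r = sqrt m, ln m = 2 ln r <= 2 r, so the quotient is at most 2 / r, and r >= 2 / q
    suffices. *)
Lemma ln_div_small (R : realType) (q : R) : 0 < q ->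
  exists n : nat, forall m, (n < m)%N -> ln m%:R / m%:R <= q.
Proof.
move=> q0; exists (Num.bound ((2 / q) ^+ 2)) => m nm.
have m0 : 0 < m%:R :> R by rewrite ltr0n; case: m nm.
have r0 : 0 < Num.sqrt m%:R :> R by rewrite sqrtr_gt0.
have rr : Num.sqrt m%:R * Num.sqrt m%:R = m%:R :> R by rewrite -expr2 sqr_sqrtr // ltW.
have qr : 2 <= q * Num.sqrt m%:R.
  have : 2 / q <= Num.sqrt m%:R.
    have <- : Num.sqrt ((2 / q) ^+ 2) = 2 / q.
      by rewrite sqrtr_sqr ger0_norm // divr_ge0 // ltW.
    apply: ler_wsqrtr.
    have := @archi_boundP R ((2 / q) ^+ 2) (sqr_ge0 _).
    by move/ltW/le_trans; apply; rewrite ler_nat ltnW.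
  by rewrite ler_pdivrMr // mulrC.
rewrite ler_pdivrMr // -rr lnM ?posrE //.
have := ln_le_self r0; nra.
Qed.

Section Potential.
Variables (R : realType) (p : R).
Hypothesis hp : 0 < p < 1.

(* [g] is the decrement [f x - f x.+1].  Beyond [s0] deletions are rare, so that
   a geometric potential decreases in mean; below [s0] they may be more
   frequent than insertions, and [g] grows fast enough to compensate. *)
Lemma potential_exists : exists (f : nat -> R) (e : R), [/\ 0 < e < 1,
  forall x, (1 / 2) ^+ x <= f x,
  forall x, f x.+1 <= f x &
  forall x, let d := p * ln x.+1%:R / x.+1%:R in
    d * f x + (1 - d) * (p * f x.+1 + (1 - p) * f x.+2) <= (1 - e) * f x.+1].
Proof.
have /andP[p0 p1] := hp.
(* As d <= p, [q] is a lower bound for the probability (1 - d)(1 - p) of an iteration with neither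
   coin nor call. *)
pose q : R := (1 - p) ^+ 2; have q0 : 0 < q by rewrite exprn_gt0 // subr_gt0.
have q1 : q < 1 by rewrite /q expr2; nra.
have [s0 small] := ln_div_small (divr_gt0 q0 (ltr0n R 4 : 0 < 4)).
pose eta : R := q / 2.
have eta0 : 0 < eta by rewrite /eta; lra.
have eta1 : eta < 1 / 2 by rewrite /eta; lra.
(* [g] grows by the factor 1 / eta up to [s0] and halves at each step beyond; [f x] is the sum of
   [g y] over all y >= x, whose part beyond [s0] is a geometric series. *)
pose g x : R := eta ^+ (s0 - x) * (1 / 2) ^+ (x - s0).
pose f x : R := 2 * (1 / 2) ^+ (x - s0) + \sum_(x <= y < s0) eta ^+ (s0 - y).
have g0 x : 0 <= g x by rewrite mulr_ge0 // exprn_ge0 //; lra.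
have fg x : f x = f x.+1 + g x.
  rewrite /f /g; have [xs|xs] := ltnP x s0.
    rewrite big_ltn // (eqP (_ : x - s0 == 0)%N) ?subn_eq0 1?ltnW //.
    by rewrite (eqP (_ : x.+1 - s0 == 0)%N) ?subn_eq0 // expr0; ring.
  rewrite !big_geq // 1?leqW // (eqP (_ : s0 - x == 0)%N) ?subn_eq0 //.
  by rewrite subSn // exprS expr0; field.
have f_low x : (1 / 2) ^+ x <= f x.
  have h : (1 / 2) ^+ x <= (1 / 2 : R) ^+ (x - s0).
    by apply: ler_wiXn2l; rewrite ?leq_subr //; lra.
  have h0 : 0 <= \sum_(x <= y < s0) eta ^+ (s0 - y).
    by apply: sumr_ge0 => y _; rewrite exprn_ge0 // ltW.
  have h1 : 0 <= (1 / 2 : R) ^+ (x - s0) by rewrite exprn_ge0 //; lra.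
  rewrite /f; lra.
(* [f x] is at most [s0 + 2] times [g x / eta ^+ s0]: below [s0] it has at most [s0] terms, each at
   most 1, plus a tail of 2. *)
have [e [e0 e1 eg]] : exists e, [/\ 0 < e, e < 1 & forall x, e * f x <= q / 2 * g x].
  have [b [b0 bE]] : exists b : R, 2 <= b /\ b = s0.+2%:R.
    by exists s0.+2%:R; rewrite ler_nat.
  have bV : b * b^-1 = 1 by rewrite divff //; lra.
  have b00 : 0 < b by lra.
  have bV0 : 0 < b^-1 by rewrite invr_gt0.
  have E0 : 0 < eta ^+ s0 by rewrite exprn_gt0.
  have E1 : eta ^+ s0 <= 1 by rewrite exprn_ile1 //; lra.
  exists (q / 2 * eta ^+ s0 * b^-1); split; first by rewrite !mulr_gt0 //; lra.
    have : b^-1 < 1 by rewrite invf_lt1 //; lra.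
    move=> bV1; have : eta ^+ s0 * b^-1 < 1 by nra.
    nra.
  move=> x; suff : eta ^+ s0 * f x <= b * g x.
    move=> h; have -> : q / 2 * eta ^+ s0 * b^-1 * f x
      = q / 2 * (eta ^+ s0 * f x / b) by ring.
    by rewrite ler_wpM2l //; [lra|rewrite ler_pdivrMr // [leRHS]mulrC].
  rewrite /g /f; have [xs|xs] := ltnP x s0.
    rewrite (eqP (_ : x - s0 == 0)%N) ?subn_eq0 1?ltnW // expr0 !mulr1.
    rewrite mulrC ler_pM //.
    - rewrite addr_ge0 //; apply: sumr_ge0 => y _; rewrite exprn_ge0 //; lra.
    - exact: ltW.
    - rewrite bE -(addn2 s0) natrD [leRHS]addrC lerD2l.
      rewrite (@le_trans _ _ (\sum_(x <= y < s0) 1)) //.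
        by apply: ler_sum => y _; rewrite exprn_ile1 //; lra.
      by rewrite big_const_nat iter_addr_0 ler_nat leq_subr.
    - by apply: ler_wiXn2l; rewrite ?leq_subr //; lra.
  rewrite big_geq // addr0 (eqP (_ : s0 - x == 0)%N) ?subn_eq0 // expr0.
  have : 0 <= (1 / 2 : R) ^+ (x - s0) by rewrite exprn_ge0 //; lra.
  set h := _ ^+ (x - s0) => h0; rewrite mul1r mulrA ler_wpM2r //.
  have := ltW E0; nra.
exists f, e; split=> //; first by rewrite e0.
  by move=> x; rewrite [leRHS]fg lerDl.
move=> x; set d := _ / _; rewrite /=.
have d0 : 0 <= d.
  by rewrite /d divr_ge0 // mulr_ge0 ?ln_ge0 ?ler1n //; lra.
have dp : d <= p.
  rewrite /d ler_pdivrMr // ler_wpM2l // ?ln_le_self //; lra.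
(* Below [s0], [g x] is q / 2 times [g x.+1]; from [s0] on it is twice [g x.+1], but then d <= q /
   4. *)
have dg : d * g x <= q / 2 * g x.+1.
  have [xs|xs] := ltnP x s0.
    have -> : g x = eta * g x.+1.
      rewrite /g (eqP (_ : x - s0 == 0)%N) ?subn_eq0 1?ltnW //.
      by rewrite (eqP (_ : x.+1 - s0 == 0)%N) ?subn_eq0 // -(subnSK xs) exprS; ring.
    have : 0 <= eta * g x.+1 by rewrite mulr_ge0 // ltW.
    rewrite -/eta; nra.
  have -> : g x = 2 * g x.+1.
    rewrite /g (eqP (_ : s0 - x == 0)%N) ?subn_eq0 //.
    by rewrite (eqP (_ : s0 - x.+1 == 0)%N) ?subn_eq0 1?leqW // subSn // exprS expr0;
      field.
  have dq : d <= q / 4.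
    have h1 := small x.+1 xs.
    have h0 : 0 <= ln x.+1%:R / x.+1%:R :> R by rewrite divr_ge0 // ln_ge0 // ler1n.
    by rewrite /d -mulrA (le_trans _ h1) // ler_piMl // ltW.
  have := g0 x.+1; nra.
(* The left side equals f (x+1) + d g x - (1 - d)(1 - p) g (x+1), which is at most f (x+1) - (q / 2)
   g (x+1); [eg] then gives the factor 1 - e. *)
have := eg x.+1; have -> : f x = f x.+1 + g x by [].
have -> : f x.+2 = f x.+1 - g x.+1 by rewrite [f x.+1]fg addrK.
have : q * g x.+1 <= (1 - d) * (1 - p) * g x.+1.
  by rewrite ler_wpM2r // /q expr2; nra.
lra.
Qed.

End Potential.

(** If t > B x, Bernoulli's inequality gives both (1 + e)^B >= 2, which cancels the factor 2^-x, and
    t - B x <= (1 + e)^(t - B x) / e. *)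
Lemma linear_le_geometric (R : realType) (e : R) (B t x : nat) :
  0 < e -> e^-1 <= B%:R ->
  t%:R <= B%:R * x%:R + e^-1 * ((1 + e) ^+ t * (1 / 2) ^+ x).
Proof.
move=> e0 eB; have eV0 : 0 < e^-1 by rewrite invr_gt0.
have h2 : 0 <= (1 / 2 : R) ^+ x by rewrite exprn_ge0 //; lra.
have he n : 0 <= (1 + e) ^+ n by rewrite exprn_ge0 //; lra.
have [tx|tx] := leqP t (B * x).
  rewrite ler_wpDr ?mulr_ge0 // ?(ltW eV0) //.
  by rewrite -natrM ler_nat.
have bern n : 1 + n%:R * e <= (1 + e) ^+ n.
  elim: n => [|n IH]; first by rewrite mul0r addr0 expr0.
  by rewrite exprS -natr1; have := ler0n R n; nra.
have h2x : 1 <= (1 + e) ^+ (B * x) * (1 / 2) ^+ x.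
  rewrite exprM -exprMn exprn_ege1 //.
  have := bern B; have : 1 <= B%:R * e by rewrite -ler_pdivrMr // mul1r.
  lra.
rewrite -(subnKC (ltnW tx)) natrD natrM lerD2l exprD.
set n := (t - B * x)%N.
have hn : n%:R <= e^-1 * (1 + e) ^+ n.
  by rewrite ler_pdivlMl //; have := bern n; lra.
apply: (le_trans hn); rewrite ler_wpM2l ?(ltW eV0) // mulrAC.
by rewrite ler_peMl.
Qed.

(** * Means over a finite product space and resampling of a coordinate *)

Section ProductMean.
Variables (R : realType) (J F : finType) (mu : J -> F -> R).
Hypothesis mu0 : forall j a, 0 <= mu j a.
Hypothesis mu1 : forall j, \sum_a mu j a = 1.

Definition weight (z : {ffun J -> F}) : R := \prod_j mu j (z j).

Definition mean (g : {ffun J -> F} -> R) : R := \sum_z weight z * g z.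

Definition upd (z : {ffun J -> F}) (j : J) (a : F) : {ffun J -> F} :=
  [ffun i => if i == j then a else z i].

Lemma weight_ge0 z : 0 <= weight z.
Proof. exact: prodr_ge0. Qed.

Lemma sum_weight : \sum_z weight z = 1.
Proof. by rewrite -bigA_distr_bigA big1. Qed.

Lemma mean_le g h : (forall z, g z <= h z) -> mean g <= mean h.
Proof. by move=> gh; apply: ler_sum => z _; rewrite ler_wpM2l // weight_ge0. Qed.

Lemma mean_ge0 g : (forall z, 0 <= g z) -> 0 <= mean g.
Proof. by move=> g0; apply: sumr_ge0 => z _; rewrite mulr_ge0 // weight_ge0. Qed.

Lemma meanZ c g : mean (fun z => c * g z) = c * mean g.
Proof. by rewrite /mean mulr_sumr; apply: eq_bigr => z _; rewrite mulrCA. Qed.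

Lemma meanD g h : mean (fun z => g z + h z) = mean g + mean h.
Proof. by rewrite /mean -big_split; apply: eq_bigr => z _; rewrite mulrDr. Qed.

Lemma mean_sum (I : Type) (r : seq I) (P : pred I) g :
  mean (fun z => \sum_(i <- r | P i) g i z) = \sum_(i <- r | P i) mean (g i).
Proof.
by rewrite /mean exchange_big /=; apply: eq_bigr => z _; rewrite mulr_sumr.
Qed.

Lemma mean_const c : mean (fun=> c) = c.
Proof. by rewrite /mean -mulr_suml sum_weight mul1r. Qed.

(* Exchanging the coordinate [z j] with a fresh copy [a] is a weight preserving
   involution of the pairs [(z, a)]. *)
Lemma mean_resample j g :
  mean g = mean (fun z => \sum_a mu j a * g (upd z j a)).
Proof.
pose swap (za : {ffun J -> F} * F) := (upd za.1 j za.2, za.1 j).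
have swapK : involutive swap.
  move=> [z a]; rewrite /swap /=; congr pair; last by rewrite ffunE eqxx.
  by apply/ffunP => i; rewrite !ffunE; case: eqP => [->|].
transitivity (\sum_z \sum_a weight z * mu j a * g z).
  by apply: eq_bigr => z _; rewrite -mulr_suml -mulr_sumr mu1 mulr1.
rewrite pair_bigA (reindex_inj (inv_inj swapK)) /=.
rewrite /mean; under [RHS]eq_bigr do rewrite mulr_sumr.
rewrite pair_bigA; apply: eq_bigr => -[z a] _ /=; rewrite mulrA; congr (_ * _).
rewrite /weight (bigD1 j) //= [in RHS](bigD1 j) //= ffunE eqxx.
rewrite (eq_bigr (fun i => mu i (z i))) => [|i /negbTE ij]; last by rewrite ffunE ij.
ring.
Qed.

End ProductMean.

(** * Mean cost of Sampling over a finite tape *)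

Section FiniteTape.
Variables (R : realType) (V : finType) (G : sgraph V) (beta C p : R) (T : nat).
Variables (tb : tie_break V) (k : costs R V) (A : R).
Hypothesis kA : costs_bounded G A k.
Hypothesis V1 : (1 < #|V|)%N.
Hypothesis hp : 0 < p < 1.
Local Notation M := (max_steps V T).

(** The start vertices [vs] are fixed: the bound is proved for each choice of them. By [mu_law], at
    a given size the coin and the test of step 3 are independent, with probabilities p and d. *)
Variables (N : nat) (vs : nat -> V) (F : finType) (cb : F -> bool) (ub : F -> R).
Variable mu : 'I_N.+1 * 'I_M.+1 -> F -> R.
Hypothesis mu0 : forall j a, 0 <= mu j a.
Hypothesis mu1 : forall j, \sum_a mu j a = 1.
Hypothesis mu_law : forall j x (h : bool -> bool -> R), (x.+1 <= #|V|)%N ->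
  let d := p * ln x.+1%:R / x.+1%:R in
  \sum_a mu j a * h (cb a) (ub a < d) =
    d * (p * h true true + (1 - p) * h false true)
    + (1 - d) * (p * h true false + (1 - p) * h false false).

Local Notation space := {ffun 'I_N.+1 * 'I_M.+1 -> F}.

(* [inord] sends the indices out of range to 0; these entries belong to runs and
   iterations that are never executed. *)
Definition finite_tape (z : space) : tape R V :=
  Tape vs (fun i t => cb (z (inord i, inord t)))
          (fun i t => ub (z (inord i, inord t))).

Variables (f : nat -> R) (e : R).
Hypothesis f0 : forall x, 0 <= f x.
Hypothesis e1 : e < 1.
Hypothesis f_decr : forall x, f x.+1 <= f x.
Hypothesis f_drift : forall x, let d := p * ln x.+1%:R / x.+1%:R in
  d * f x + (1 - d) * (p * f x.+1 + (1 - p) * f x.+2) <= (1 - e) * f x.+1.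
Variable B : nat.
Hypothesis e0 : 0 < e.
Hypothesis eB : e^-1 <= B%:R.
Hypothesis f_low : forall x, (1 / 2) ^+ x <= f x.

Local Notation K := (T.+1%:R * (1 + B%:R + f 1 * e^-1 ^+ 3)).

Section OneRun.
Variable i : nat.
Hypothesis iN : (i <= N)%N.

Local Notation cont z := (continues G beta C p T tb (finite_tape z) i).
Local Notation cfg z t := (run_config G beta p T tb (finite_tape z) i t).
Local Notation size_at z t := #|dom (cur_set (cfg z t))|.
Local Notation pos t := (inord i, inord t).

(** Resampling a coordinate of row i leaves the earlier runs alone. *)
Lemma continues_upd t z a : cont (upd z (pos t) a) = cont z.
Proof.
rewrite /continues (@sampling_at_agree _ _ G beta C p T tb _ (finite_tape z)) //.
move=> j ji; split=> // t' _; rewrite /=.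
have -> : (upd z (pos t) a) (inord j, inord t') = z (inord j, inord t').
  rewrite ffunE ifN // xpair_eqE negb_and -val_eqE /= !inordK ?ltnS //.
    by rewrite neq_ltn ji.
  exact: leq_trans (ltnW ji) iN.
by split.
Qed.

Lemma config_upd t t' z a : (t' <= t)%N -> (t <= M)%N ->
  cfg (upd z (pos t) a) t' = cfg z t'.
Proof.
move=> tt tM; apply: (@config_at_agree _ _ _ _ _ _ _ _ t') => // r rt.
rewrite /=; have -> : (upd z (pos t) a) (pos r) = z (pos r).
  rewrite ffunE ifN // xpair_eqE negb_and; apply/orP; right.
  rewrite -val_eqE /= !inordK ?ltnS //; last by lia.
  by rewrite neq_ltn (leq_trans rt).
by split.
Qed.

(** Conditional expectation given the past of iteration t: the entry (i, t) is resampled, on which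
    neither the guard nor the configuration at time t depends. [H] takes the configuration, the coin
    and the outcome of the test. *)
Lemma mean_step t (H : config R V -> bool -> bool -> R) (g : space -> R) :
    (t < M)%N ->
    (forall z a, g (upd z (pos t) a) <= (cont z)%:R * ((running G (cfg z t))%:R *
       H (cfg z t) (cb a) (ub a < p * ln (size_at z t)%:R / (size_at z t)%:R))) ->
  mean mu g <= mean mu (fun z => (cont z)%:R * ((running G (cfg z t))%:R *
    let d := p * ln (size_at z t)%:R / (size_at z t)%:R in
    d * (p * H (cfg z t) true true + (1 - p) * H (cfg z t) false true)
    + (1 - d) * (p * H (cfg z t) true false + (1 - p) * H (cfg z t) false false))).
Proof.
move=> tM gH; rewrite (mean_resample mu1 (pos t)); apply: mean_le => // z.
have [+ _] := dom_gt0 G beta p T tb (t_vertex (finite_tape z) i)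
  (t_coin (finite_tape z) i) (t_unif (finite_tape z) i) t.
have := max_card (mem (dom (cur_set (cfg z t)))).
rewrite -/(run_config G beta p T tb (finite_tape z) i t).
have {gH} := gH z; set c := cfg z t; case: #|dom (cur_set c)| => // x gH xV _.
have lawE := mu_law (pos t) (H c) xV; cbv zeta in lawE |- *.
rewrite -lawE !mulr_sumr; apply: ler_sum => a _.
by rewrite [X in _ <= _ * X]mulrCA [leRHS]mulrCA ler_wpM2l.
Qed.

(** At size X a call has probability p ln X / X, so X times its indicator has conditional mean p ln
    X <= ln n. *)
Lemma mean_deleval t : (t < M)%N ->
  mean mu (fun z => (cont z)%:R * ((running G (cfg z t))%:R *
    ((calls_deleval p (t_unif (finite_tape z) i) t (cfg z t))%:R
     * (size_at z t)%:R)))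
  <= ln #|V|%:R * mean mu (fun z => (cont z)%:R * (running G (cfg z t))%:R).
Proof.
move=> tM.
apply: (le_trans (mean_step (H := fun c _ q => q%:R * #|dom (cur_set c)|%:R) tM _)).
  move=> z a; rewrite continues_upd ?(ltnW tM) // config_upd ?(ltnW tM) //.
  by rewrite /calls_deleval /= ffunE eqxx.
rewrite -meanZ; apply: mean_le => // z; cbv zeta.
have [+ _] := dom_gt0 G beta p T tb (t_vertex (finite_tape z) i)
  (t_coin (finite_tape z) i) (t_unif (finite_tape z) i) t.
rewrite -/(run_config G beta p T tb (finite_tape z) i t) => X0.
have XV : ln (size_at z t)%:R <= ln #|V|%:R :> R.
  by rewrite ler_ln ?posrE ?ltr0n ?(leq_trans X0) ?max_card // ler_nat max_card.
rewrite [leRHS]mulrC -[leRHS]mulrA !ler_wpM2l //.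
have X00 : (size_at z t)%:R != 0 :> R by rewrite pnatr_eq0 -lt0n.
have L0 : 0 <= ln (size_at z t)%:R :> R by rewrite ln_ge0 // ler1n.
move: X00 L0 XV; set X := (size_at z t)%:R; set L := ln X => X00 L0 XV.
have -> : p * L / X * (p * (true%:R * X) + (1 - p) * (true%:R * X))
   + (1 - p * L / X) * (p * (false%:R * X) + (1 - p) * (false%:R * X)) = p * L.
  by rewrite !mul0r !mul1r; field.
by rewrite (le_trans _ XV) // ler_piMl // ltW //; case/andP: hp.
Qed.

Local Notation live z t := (live G beta p T tb (t_vertex (finite_tape z) i)
  (t_coin (finite_tape z) i) (t_unif (finite_tape z) i) t).

Lemma f_anti x y : (x <= y)%N -> f y <= f x.
Proof.
move=> /subnK <-; elim: (y - x)%N => // n IH; exact: le_trans (f_decr _) IH.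
Qed.

Lemma mean_drift t : (t < M)%N ->
  mean mu (fun z => (cont z)%:R * ((live z t.+1)%:R * f (size_at z t.+1)))
  <= (1 - e) * mean mu (fun z => (cont z)%:R * ((live z t)%:R * f (size_at z t))).
Proof.
move=> tM.
(* An upper bound for the next potential, [f] being decreasing: a call loses at most one vertex, a
   coin without a call loses none, and otherwise one vertex is gained. *)
pose H (c : config R V) b q := let X := #|dom (cur_set c)| in
  if q then f X.-1 else if b then f X else f X.+1.
apply: (le_trans (mean_step (H := H) tM _)).
  move=> z a; rewrite continues_upd ?(ltnW tM) // ler_wpM2l //.
  rewrite [live _ _]/= -/(run_config G beta p T tb (finite_tape (upd z (pos t) a)) i t).
  rewrite {1}config_upd ?(ltnW tM) //; case: (boolP (running G (cfg z t))) => rt;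
    last by rewrite !mul0r.
  rewrite !mul1r [cfg (upd z (pos t) a) t.+1]/run_config [config_at _ _ _ _ _ _ _ _ _]/=.
  rewrite -/(run_config G beta p T tb (finite_tape (upd z (pos t) a)) i t).
  rewrite config_upd ?(ltnW tM) // rt.
  have [_ s2 s3 s4] := step_size beta p T tb (vs i)
    (t_coin (finite_tape (upd z (pos t) a)) i)
    (t_unif (finite_tape (upd z (pos t) a)) i) t rt.
  move: s2 s3 s4; rewrite /calls_deleval /= ffunE eqxx /H.
  case: ifP => q; first by move=> s2 _ _; apply: f_anti; lia.
  case: ifP => b; first by move=> s2 _ _; apply: f_anti; lia.
  by move=> _ _ ->.
rewrite -meanZ; apply: mean_le => // z; cbv zeta.
rewrite [leRHS]mulrCA ler_wpM2l //.
have live_running : running G (cfg z t) -> live z t.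
  by case: t tM => // t _ /running_pred.
have [+ _] := dom_gt0 G beta p T tb (t_vertex (finite_tape z) i)
  (t_coin (finite_tape z) i) (t_unif (finite_tape z) i) t.
rewrite -/(run_config G beta p T tb (finite_tape z) i t).
case: (boolP (running G (cfg z t))) live_running => rt lr X0; last first.
  by rewrite mul0r; apply: mulr_ge0; [rewrite subr_ge0 ltW|exact: mulr_ge0].
rewrite lr // !mul1r /H; case: #|_| X0 => // x _.
apply: (le_trans _ (f_drift x)); rewrite /=.
rewrite le_eqVlt; apply/orP; left; apply/eqP; ring.
Qed.

Lemma mean_potential t : (t <= M)%N ->
  mean mu (fun z => (cont z)%:R * ((live z t)%:R * f (size_at z t)))
  <= (1 - e) ^+ t * (f 1 * mean mu (fun z => (cont z)%:R)).
Proof.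
elim: t => [_|t IH tM].
  rewrite expr0 mul1r -meanZ; apply: mean_le => // z.
  by rewrite mul1r dom_init mulrC.
apply: (le_trans (mean_drift tM)); rewrite exprS -mulrA ler_wpM2l ?subr_ge0 ?(ltW e1) //.
exact/IH/ltnW.
Qed.

Local Notation fsize z := (final_size G beta p T tb (finite_tape z) i).

Lemma fsize_gt0 z : (0 < fsize z)%N.
Proof.
by have [] := dom_gt0 G beta p T tb (t_vertex (finite_tape z) i)
  (t_coin (finite_tape z) i) (t_unif (finite_tape z) i) M.
Qed.

(** The growth (1 + e)^t loses against the decay (1 - e)^t, the ratio being 1 - e^2. *)
Lemma geometric_sum_le n : \sum_(t < n) ((1 + e) ^+ t * (1 - e) ^+ t) <= e^-1 ^+ 2.
Proof.
rewrite (eq_bigr (fun t : 'I_n => (1 - e ^+ 2) ^+ t)) => [|t _]; last first.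
  by rewrite -exprMn; congr (_ ^+ _); ring.
have := subrX1 (1 - e ^+ 2) n.
have -> : 1 - e ^+ 2 - 1 = - e ^+ 2 by ring.
set S := \sum_(_ < _) _ => h.
have q0 : 0 <= (1 - e ^+ 2) ^+ n.
  by rewrite exprn_ge0 // subr_ge0 exprn_ile1 // ltW.
have e2 : 0 < e ^+ 2 by rewrite exprn_gt0.
have hS : S * e ^+ 2 = 1 - (1 - e ^+ 2) ^+ n.
  by rewrite mulrC; apply: oppr_inj; rewrite opprB h mulNr.
by rewrite exprVn -[leRHS]mul1r ler_pdivlMr // hS lerBlDr lerDl.
Qed.

(** In [K], T + 1 comes from the counter, B from [linear_le_geometric], and f(1) / e^3 from the
    initial potential at size 1, the factor 1 / e and the geometric sum. Constants are absorbed
    since |S_opt| >= 1. *)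
Lemma mean_hist :
  mean mu (fun z => (cont z)%:R * (size (hist (cfg z M)))%:R)
  <= K * mean mu (fun z => (cont z)%:R * (fsize z)%:R).
Proof.
have eV0 : 0 < e^-1 by rewrite invr_gt0.
have e10 : 0 < 1 + e by rewrite addr_gt0.
pose W t z := (cont z)%:R * ((live z t)%:R * f (size_at z t)).
apply: (@le_trans _ _ (mean mu (fun z => T.+1%:R * ((1 + B%:R) * ((cont z)%:R * (fsize
  z)%:R)
    + \sum_(t < M.+1) e^-1 * (1 + e) ^+ t * W t z)))).
  apply: mean_le => // z.
  set coin := t_coin (finite_tape z) i; set u := t_unif (finite_tape z) i.
  have h1 := hist_size_le G beta p T tb (vs i) coin u M.
  have h2 : (size (hist (cfg z M)) - pending (cfg z M))%:R <=
      B%:R * (fsize z)%:R + \sum_(t < M.+1) (live z t)%:R *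
        (e^-1 * ((1 + e) ^+ t * f (size_at z t))).
    apply: (@last_improvement_le R V G beta p T tb (vs i) coin u B%:R
      (fun t x => e^-1 * ((1 + e) ^+ t * f x)) M).
      by move=> t x; rewrite mulr_ge0 ?(ltW eV0) // mulr_ge0 ?exprn_ge0 ?(ltW e10).
    move=> t x; apply: (le_trans (linear_le_geometric t x e0 eB)).
    by rewrite lerD2l ler_wpM2l ?(ltW eV0) // ler_wpM2l ?exprn_ge0 ?(ltW e10).
  rewrite mulrDr mulr_sumr; case: (boolP (cont z)) => cz; last first.
    rewrite /W (negbTE cz) !mul0r !mulr0 add0r big1 // => t _.
    by rewrite mul0r !mulr0.
  rewrite -mulr_sumr -mulrDr !mul1r.
  apply: (@le_trans _ _ (T.+1 * (size (hist (cfg z M)) - pending (cfg z M)).+1)%:R).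
    by rewrite ler_nat.
  rewrite natrM ler_wpM2l // -natr1 mulrDl mul1r addrC -addrA lerD //.
    by rewrite ler1n fsize_gt0.
  apply: (le_trans h2); rewrite lerD2l; apply: ler_sum => t _.
  by rewrite /W cz mul1r le_eqVlt; apply/orP; left; apply/eqP; ring.
rewrite meanZ meanD meanZ mean_sum -mulrA ler_wpM2l // [leRHS]mulrDl lerD //.
have cf : mean mu (fun z => (cont z)%:R) <= mean mu (fun z => (cont z)%:R * (fsize z)%:R).
  by apply: mean_le => // z; rewrite ler_peMr // ler1n fsize_gt0.
have c0 : 0 <= mean mu (fun z => (cont z)%:R) by exact: mean_ge0.
set Ec := mean mu (fun z => (cont z)%:R) in cf c0 *.
apply: (@le_trans _ _ (f 1 * e^-1 ^+ 3 * Ec)); last first.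
  by rewrite ler_wpM2l // mulr_ge0 // exprn_ge0 // ltW.
apply: (@le_trans _ _ (\sum_(t < M.+1) e^-1 * (f 1 * Ec) * ((1 + e) ^+ t * (1 - e) ^+
  t))).
  apply: ler_sum => t _; rewrite meanZ.
  have := mean_potential (ltn_ord t : (t <= M)%N); rewrite -/Ec => h.
  rewrite [leRHS](_ : _ = e^-1 * (1 + e) ^+ t * ((1 - e) ^+ t * (f 1 * Ec)));
    last by ring.
  by rewrite ler_wpM2l // mulr_ge0 ?exprn_ge0 // ltW.
rewrite -mulr_sumr [leRHS](_ : _ = e^-1 * (f 1 * Ec) * e^-1 ^+ 2); last by ring.
by rewrite ler_wpM2l ?geometric_sum_le // !mulr_ge0 // ltW.
Qed.

(** The factor 7 is the 6 of [search_cost_le] plus 1 for the calls of [DelEval], each executed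
    iteration costing at most ln n in mean for them. *)
Lemma mean_run_cost :
  mean mu (fun z => (cont z)%:R * run_cost G beta p T tb k (finite_tape z) i)
  <= A * (maxn 1 (max_degree G))%:R * ln #|V|%:R * (10 + 7 * K)
     * mean mu (fun z => (cont z)%:R * (fsize z)%:R).
Proof.
set D := (maxn 1 (max_degree G))%:R; set l := ln #|V|%:R.
have AD0 : 0 <= A * D by rewrite mulr_ge0 // (le_trans ler01) // (cost_const_ge1 kA).
have l0 : 0 <= l by rewrite ln_ge0 // ler1n ltnW.
pose dele z : R := \sum_(t < M) (cont z)%:R * ((running G (cfg z t))%:R *
    ((calls_deleval p (t_unif (finite_tape z) i) t (cfg z t))%:R
     * (size_at z t)%:R)).
apply: (@le_trans _ _ (mean mu (fun z => A * D * (10 * l * ((cont z)%:R * (fsize z)%:R)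
    + 6 * l * ((cont z)%:R * (size (hist (cfg z M)))%:R) + dele z)))).
  apply: mean_le => // z; rewrite /dele -mulr_sumr.
  have := search_cost_le beta p T tb kA V1 (vs i) (t_coin (finite_tape z) i)
    (t_unif (finite_tape z) i).
  set X := (#|dom (opt_set _)|%:R); set Y := (size _)%:R; set S := (\sum_(t < _) _).
  move=> h; rewrite /run_cost /final_size.
  apply: (le_trans (ler_wpM2l _ h)) => //.
  by rewrite le_eqVlt; apply/orP; left; apply/eqP; rewrite -/D -/l; ring.
have hd : mean mu dele <= l * mean mu (fun z => (cont z)%:R * (size (hist (cfg z M)))%:R).
  rewrite mean_sum; apply: (@le_trans _ _ (\sum_(t < M) l *
    mean mu (fun z => (cont z)%:R * (running G (cfg z t))%:R))).
    by apply: ler_sum => t _; apply: mean_deleval.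
  rewrite -mulr_sumr -mean_sum ler_wpM2l //; apply: mean_le => // z.
  by rewrite -mulr_sumr [size _]hist_size natr_sum.
rewrite meanZ !meanD !meanZ; have := mean_hist.
set EH := mean mu (fun z => _ * (size _)%:R) in hd *; set EF := mean mu _ => h.
have h4 : l * EH <= l * (K * EF) by rewrite ler_wpM2l.
have -> : A * D * l * (10 + 7 * K) * EF =
  A * D * (10 * l * EF + 6 * (l * (K * EF)) + l * (K * EF)) by ring.
rewrite ler_wpM2l //; apply: lerD; last exact: le_trans hd h4.
by rewrite lerD2l -mulrA ler_wpM2l.
Qed.

End OneRun.

(** The bounds of the runs are proportional to their sizes, which sum pathwise to the total size. *)
Lemma mean_sampling_cost : 0 < C ->
  mean mu (fun z => sampling_cost G beta C p T tb k (finite_tape z) N.+1)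
  <= A * (maxn 1 (max_degree G))%:R * ln #|V|%:R * (10 + 7 * K)
     * ((C + 1) * #|V|%:R).
Proof.
move=> C0; rewrite /sampling_cost mean_sum.
apply: le_trans (_ : \sum_(i < N.+1) _ <= _) _.
  by apply: ler_sum => i _; apply: mean_run_cost; rewrite -ltnS.
rewrite -mulr_sumr -mean_sum ler_wpM2l //.
  have K0 : 0 <= K by rewrite mulr_ge0 // !addr_ge0 // mulr_ge0 // exprn_ge0 //
    invr_ge0 ltW.
  have A0 : 0 <= A by rewrite (le_trans ler01) // (cost_const_ge1 kA).
  have l0 : 0 <= ln #|V|%:R :> R by rewrite ln_ge0 // ler1n ltnW.
  by rewrite !mulr_ge0 // addr_ge0 // mulr_ge0.
rewrite -[leRHS](mean_const mu1); apply: mean_le => // z.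
apply: le_trans (total_size_le G beta p T tb (finite_tape z) C0 N.+1).
rewrite total_sizeE natr_sum le_eqVlt; apply/orP; left; apply/eqP.
by apply: eq_bigr => i _; rewrite natrM.
Qed.

End FiniteTape.

(** * Integrals of functions of a finitely valued random variable *)

Section FiniteValued.
Context {d : measure_display} {Omega : measurableType d} {R : realType}.
Variables (P : probability Omega R) (I : finType) (Z : Omega -> I).
Hypothesis mZ : forall q, measurable [set x | Z x = q]%classic.

Lemma integral_finite_valued (h : I -> R) : (forall q, 0 <= h q) ->
  (\int[P]_x (h (Z x))%:E = \sum_q (h q)%:E * P [set x | Z x = q]%classic)%E.
Proof.
move=> h0.
transitivity (\int[P]_x (\sum_q (h q)%:E * (\1_[set x | Z x = q]%classic x)%:E))%E.
  apply: eq_integral => x _; rewrite (bigD1 (Z x)) //= big1 => [|q qZ].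
    by rewrite adde0 indicE mem_set // mule1.
  by rewrite indicE memNset ?mule0 //= => /esym/eqP; rewrite (negbTE qZ).
rewrite ge0_integral_sum //; last 2 first.
- by move=> q; apply: measurable_funeM; apply/measurable_EFinP; exact: measurable_indic.
- by move=> q x _; rewrite mule_ge0 // lee_fin h0.
apply: eq_bigr => q _; rewrite ge0_integralZl //.
- by rewrite integral_indic // setIT.
- by apply/measurable_EFinP; exact: measurable_indic.
- exact: h0.
Qed.

Lemma sum_finite_valued (S : pred I) : measurable [set x | S (Z x)]%classic ->
  \sum_(q | S q) fine (P [set x | Z x = q]%classic) = fine (P [set x | S (Z x)]%classic).
Proof.
move=> mS; apply: EFin_inj.
rewrite fineK ?fin_num_measure // -sumEFin.
rewrite -[X in _ = P X]setIT -integral_indic //.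
transitivity (\int[P]_x ((S (Z x))%:R : R)%:E)%E; last first.
  apply: eq_integral => x _; rewrite indicE; congr (_%:R%:E).
  by case: (boolP (S (Z x))) => Sx; [rewrite mem_set|rewrite memNset //= (negbTE Sx)].
rewrite (integral_finite_valued (h := fun q => (S q)%:R)) // big_mkcond.
apply: eq_bigr => q _; case: (S q); rewrite ?mul0e ?mul1e //.
by rewrite fineK ?fin_num_measure.
Qed.

End FiniteValued.

(** * Discretisation of the random tape and its product law *)

Section Discretisation.
Variables (R : realType) (V : finType) (p : R).

Local Notation level := {ffun 'I_#|V|.+1 -> bool}.

Definition levels (a : R) : level := [ffun x : 'I_#|V|.+1 => a < p * ln x%:R / x%:R].

(** A number with the same outcomes in all tests of step 3; the default 0 serves patterns that no
    number realises. *)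
Definition representative (q : level) : R := xget 0 [set a | levels a = q]%classic.

Lemma levels_representative a : levels (representative (levels a)) = levels a.
Proof. exact: (@xgetPex _ 0 [set b | levels b = levels a]%classic) (ex_intro _ a
  erefl). Qed.

Lemma measurable_levels q : measurable [set a | levels a = q]%classic.
Proof.
have -> : [set a | levels a = q]%classic =
    \big[setI/setT]_(x : 'I_#|V|.+1) [set a | (a < p * ln x%:R / x%:R) = q x]%classic.
  rewrite -bigcap_seq; apply/seteqP; split => a /=.
    by move=> <- x _ /=; rewrite ffunE.
  by move=> aq; apply/ffunP => x; rewrite ffunE; apply: aq; rewrite /= mem_index_enum.
apply: bigsetI_measurable => x _; set c := _ / _; case: (q x).
  have -> : [set a | (a < c) = true]%classic = `]-oo, c[%classic.
    by apply/seteqP; split => a /=; rewrite in_itv.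
  exact: measurable_itv.
have -> : [set a | (a < c) = false]%classic = `[c, +oo[%classic.
  by apply/seteqP; split => a /=; rewrite in_itv /= andbT leNgt; [move=> ->|move/negbTE].
exact: measurable_itv.
Qed.

Context {d : measure_display} {Omega : measurableType d}.
Variables (P : probability Omega R) (w : Omega -> tape R V).
Hypothesis hp : 0 < p < 1.
Hypothesis V1 : (1 < #|V|)%N.
Hypothesis hw : random_tape P p w.

Definition coin_weight (b : bool) : R := if b then p else 1 - p.

Lemma measurable_coin i t b : measurable [set x | t_coin (w x) i t = b]%classic.
Proof.
have [m _ _ _ _] := hw; apply: (m (inl (inr (i, t)))).
by exists [set b]%classic.
Qed.

Lemma measurable_unif i t B : measurable B ->
  measurable [set x | B (t_unif (w x) i t)]%classic.
Proof. by have [m _ _ _ _] := hw => mB; apply: (m (inr (i, t))); exists B. Qed.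

Lemma prob_coin i t b :
  P [set x | t_coin (w x) i t = b]%classic = (coin_weight b)%:E.
Proof.
have [_ _ hcoin _ _] := hw; case: b => /=; first exact: hcoin.
have -> : [set x | t_coin (w x) i t = false]%classic =
    (~` [set x | t_coin (w x) i t = true])%classic.
  by apply/seteqP; split => x /=; case: t_coin.
rewrite probability_setC; last exact: measurable_coin.
by rewrite -[X in P X]/[set x | t_coin (w x) i t]%classic hcoin.
Qed.

Variables N M : nat.
Local Notation J := ('I_N.+1 * 'I_M.+1)%type.

Definition law (j : J) (a : bool * level) : R := coin_weight a.1
  * fine (P [set x | levels (t_unif (w x) j.1 j.2) = a.2]%classic).

Definition discrete_tape (x : Omega) : {ffun 'I_N.+1 -> V} * {ffun J -> bool * level} :=
  ([ffun i : 'I_N.+1 => t_vertex (w x) i],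
   [ffun j : J => (t_coin (w x) j.1 j.2, levels (t_unif (w x) j.1 j.2))]).

Let cell (vs : {ffun 'I_N.+1 -> V}) (z : {ffun J -> bool * level})
    (k : nat + (nat * nat) + (nat * nat)) : set Omega :=
  match k with
  | inl (inl i) => [set x | t_vertex (w x) i = vs (inord i)]%classic
  | inl (inr (i, t)) => [set x | t_coin (w x) i t = (z (inord i, inord t)).1]%classic
  | inr (i, t) => [set x | levels (t_unif (w x) i t) = (z (inord i, inord t)).2]%classic
  end.

Let source (k : 'I_N.+1 + J + J) : nat + (nat * nat) + (nat * nat) :=
  match k with
  | inl (inl i) => inl (inl (val i))
  | inl (inr j) => inl (inr (val j.1, val j.2))
  | inr j => inr (val j.1, val j.2)
  end.

Lemma source_inj : injective source.
Proof.
by move=> [[i|[i t]]|[i t]] [[i'|[i' t']]|[i' t']] //= [] => [/val_inj->|/val_inj->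
  /val_inj->|/val_inj-> /val_inj->].
Qed.

Lemma cell_event vs z k : source_events w k (cell vs z k).
Proof.
case: k => [[i|[i t]]|[i t]] /=.
- by exists [set vs (inord i)]%classic.
- by exists [set (z (inord i, inord t)).1]%classic.
- by exists [set a | levels a = (z (inord i, inord t)).2]%classic;
    first exact: measurable_levels.
Qed.

Lemma discrete_tape_fiber vs z : [set x | discrete_tape x = (vs, z)]%classic =
  \big[setI/setT]_(k <- [seq source k | k <- enum {: 'I_N.+1 + J + J}]) cell vs z k.
Proof.
rewrite -bigcap_seq; apply/seteqP; split => x /=.
  move=> [<- <-] _ /mapP[[[i|[i t]]|[i t]] _ ->] /=;
  by rewrite !ffunE /= ?inord_val.
move=> h; have {}h k : cell vs z (source k) x by apply: h; rewrite /= map_f // mem_enum.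
rewrite /discrete_tape; congr (_, _); [apply/ffunP => i|apply/ffunP => -[i t]];
  rewrite ffunE.
  by have := h (inl (inl i)); rewrite /= inord_val.
have /= := h (inl (inr (i, t))); have /= := h (inr (i, t)).
by rewrite !inord_val; case: (z _) => ? ? /= -> ->.
Qed.

Lemma measurable_discrete_tape q : measurable [set x | discrete_tape x = q]%classic.
Proof.
case: q => vs z; rewrite discrete_tape_fiber; apply: bigsetI_measurable => k _.
by have [m _ _ _ _] := hw; apply: (m k); exact: cell_event.
Qed.

(** A fibre is an intersection of events of distinct sources, so independence turns its probability
    into a product. *)
Lemma prob_discrete_tape vs z : P [set x | discrete_tape x = (vs, z)]%classic =
  ((\prod_(i < N.+1) #|V|%:R^-1) * weight law z)%:E.
Proof.
have [_ hv _ _ indep] := hw.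
rewrite discrete_tape_fiber indep; last 2 first.
- by rewrite (map_inj_uniq source_inj) enum_uniq.
- by move=> k _; exact: cell_event.
rewrite big_map big_enum /= !big_sumType /= /weight.
rewrite (eq_bigr (fun=> (#|V|%:R^-1)%:E)) => [|i _]; last exact: hv.
rewrite [X in (_ * X * _)%E](eq_bigr (fun j => (coin_weight (z j).1)%:E)) => [|[i t]
  _]; last first.
  by rewrite prob_coin !inord_val.
rewrite [X in (_ * _ * X)%E](eq_bigr (fun j : J =>
   (fine (P [set x | levels (t_unif (w x) j.1 j.2) = (z j).2]%classic))%:E)) => [|[i t]
     _]; last first.
  rewrite /= !inord_val fineK // fin_num_measure //.
  exact: (measurable_unif i t (measurable_levels _)).
by rewrite !prodEFin -!EFinM -mulrA -big_split.
Qed.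

Lemma law_ge0 j a : 0 <= law j a.
Proof.
rewrite mulr_ge0 ?fine_ge0 // /coin_weight; case/andP: hp => h1 h2.
by case: a.1; rewrite ?subr_ge0 ltW.
Qed.

Lemma law_levels j x (h : bool -> bool -> R) : (x.+1 <= #|V|)%N ->
  let D := p * ln x.+1%:R / x.+1%:R in
  \sum_a law j a * h a.1 (representative a.2 < D) =
    D * (p * h true true + (1 - p) * h false true)
    + (1 - D) * (p * h true false + (1 - p) * h false false).
Proof.
move=> xV D; set Q := fun q => fine (P [set y | levels (t_unif (w y) j.1 j.2) =
  q]%classic).
have xV' : (x.+1 < #|V|.+1)%N by [].
have D01 : 0 <= D <= 1.
  have := @ln_le_self R x.+1%:R (ltr0Sn _ _); have := @ln_ge0 R x.+1%:R;
    rewrite ler1n => /(_ isT).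
  case/andP: hp => p0 p1 l0 lx; rewrite /D divr_ge0 ?mulr_ge0 ?(ltW p0) //=.
  by rewrite ler_pdivrMr ?ltr0Sn // mul1r (le_trans _ lx) // ler_piMl // ltW.
have mQ q : measurable [set y | levels (t_unif (w y) j.1 j.2) = q]%classic.
  exact: (measurable_unif j.1 j.2 (measurable_levels q)).
have mD : measurable [set y | t_unif (w y) j.1 j.2 < D]%classic.
  apply: (measurable_unif j.1 j.2 (B := [set a | a < D]%classic)).
  have -> : [set a | a < D]%classic = `]-oo, D[%classic.
    by apply/seteqP; split => a /=; rewrite in_itv.
  exact: measurable_itv.
have PD : fine (P [set y | t_unif (w y) j.1 j.2 < D]%classic) = D.
  by have [_ _ _ -> //] := hw.
have levD y : levels (t_unif (w y) j.1 j.2) (Ordinal xV') = (t_unif (w y) j.1 j.2 < D).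
  by rewrite ffunE.
have sT : \sum_(q : level | q (Ordinal xV')) Q q = D.
  rewrite (@sum_finite_valued _ _ _ P _ _ mQ (fun q : level => q (Ordinal xV'))).
    rewrite -[RHS]PD; congr (fine (P _)); apply/seteqP; split => y /=; by rewrite levD.
  by rewrite (_ : mkset _ = [set y | t_unif (w y) j.1 j.2 < D]%classic) //;
    apply/seteqP; split => y /=; rewrite levD.
have sF : \sum_(q : level | ~~ q (Ordinal xV')) Q q = 1 - D.
  have : \sum_(q : level) Q q = 1.
    rewrite (@sum_finite_valued _ _ _ P _ _ mQ xpredT).
      by rewrite (_ : mkset _ = setT) ?probability_setT //; apply/seteqP; split.
    by rewrite (_ : mkset _ = setT) //; apply/seteqP; split.
  by rewrite (bigID (fun q : level => q (Ordinal xV'))) /= sT => <-;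
    rewrite addrAC subrr add0r.
(* Unrealised patterns, whose representative is meaningless, have weight 0. *)
have rep (q : level) : Q q * h true (representative q < D) = Q q * h true (q (Ordinal
  xV')) /\
   Q q * h false (representative q < D) = Q q * h false (q (Ordinal xV')).
  have [[a <-]|nq] := pselect (exists a, levels a = q).
    suff -> : (representative (levels a) < D) = levels a (Ordinal xV') by [].
    by rewrite -[in RHS](levels_representative a) ffunE.
  have -> : Q q = 0; last by rewrite !mul0r.
  rewrite /Q (_ : mkset _ = set0) ?measure0 //.
  by apply/seteqP; split => y //= yq; case: nq; eexists; exact: yq.
transitivity (\sum_(q : level) Q q * (p * h true (q (Ordinal xV')) + (1 - p) * h false
  (q (Ordinal xV')))).
  rewrite -(pair_bigA _ (fun b q => law j (b, q) * h b (representative q < D))) /=.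
  rewrite big_bool /= -big_split; apply: eq_bigr => q _ /=.
  rewrite /law /= -!mulrA; have [-> ->] := rep q; ring.
rewrite (bigID (fun q : level => q (Ordinal xV'))) /=; congr (_ + _).
  by rewrite -sT mulr_suml; apply: eq_bigr => q ->.
by rewrite -sF mulr_suml; apply: eq_bigr => q /negbTE ->.
Qed.

Lemma sum_law j : \sum_a law j a = 1.
Proof.
have := @law_levels j 0 (fun _ _ => 1) (ltnW V1); cbv zeta.
under eq_bigr do rewrite mulr1.
by move=> ->; ring.
Qed.

End Discretisation.

(** Replaces the random tape by its discretisation without changing any executed run. *)
Lemma tapes_agree_discrete (R : realType) (V : finType) (p : R) (T N : nat)
    (d : measure_display) (Omega : measurableType d) (w : Omega -> tape R V)
    (x : Omega) :
  let Z := discrete_tape p w N (max_steps V T) x in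
  tapes_agree p T N.+1 (w x) (finite_tape (fun i => Z.1 (inord i))
    (fun a => a.1) (fun a => representative p a.2) Z.2).
Proof.
move=> Z i iN; split; first by rewrite /= ffunE inordK.
move=> t tM; have tM' : (t < (max_steps V T).+1)%N by exact: ltnW.
rewrite /= ffunE /= (inordK iN) (inordK tM'); split=> // m mV.
have xV : (m < #|V|.+1)%N by [].
have := congr1 (fun q : {ffun 'I_#|V|.+1 -> bool} => q (Ordinal xV))
  (levels_representative V p (t_unif (w x) i t)).
by rewrite !ffunE /= => ->.
Qed.

(** * The bound on the expected running time *)

Theorem lemma4p5 (R : realType) (p : R) (T : nat) (c A : R)
    (hp : 0 < p < 1) (hT : (0 < T)%N) (hc : 0 < c) :
  exists K : R, 0 < K /\
  forall (V : finType) (G : sgraph V) (beta C : R)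
         (tb : tie_break V) (k : costs R V)
         (d : measure_display) (Omega : measurableType d)
         (P : probability Omega R) (w : Omega -> tape R V),
    (1 < #|V|)%N ->
    0 < beta <= 1 ->
    0 < C ->
    costs_bounded G A k ->
    random_tape P p w ->
    exists E : set Omega,
      [/\ measurable E,
          ((1 - #|V|%:R `^ (- c))%:E <= P E)%E &
          (cond_expectation P E (fun x => sampling_time G beta C p T tb k (w x))
           <= (K * ((maxn 1 (max_degree G))%:R * (C + 1)
                    * #|V|%:R * ln #|V|%:R ^+ 2))%:E)%E].
Proof.
have [f [e [/andP[e0 e1] f_low f_decr f_drift]]] := potential_exists hp.
pose B := Num.bound e^-1.
have eV0 : 0 < e^-1 by rewrite invr_gt0.
have eB : e^-1 <= B%:R by apply: ltW; apply: archi_boundP; exact: ltW.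
have f0 x : 0 <= f x by rewrite (le_trans _ (f_low x)) // exprn_ge0 //; lra.
pose K2 := T.+1%:R * (1 + B%:R + f 1%N * e^-1 ^+ 3).
have K20 : 0 <= K2.
  by rewrite mulr_ge0 // !addr_ge0 // mulr_ge0 // exprn_ge0 // ltW.
(* [A] is quantified before [K], so its absolute value plus 1 keeps [K] positive; the factor 2 pays
   for ln n <= 2 (ln n)^2. *)
exists (2 * (`|A| + 1) * (10 + 7 * K2)); split.
  by have := normr_ge0 A => A0; rewrite !mulr_gt0 //; lra.
move=> V G beta C tb k d Omega P w V1 _ C0 kA hw.
exists setT; split; first exact: measurableT.
  by rewrite probability_setT lee_fin gerBl powR_ge0.
rewrite /cond_expectation probability_setT invr1 mule1.
(* No run starts from index [N.+1] on, so [N.+1] rows of the tape suffice. *)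
pose N := Num.bound (C * #|V|%:R).
have CN : C * #|V|%:R <= N.+1%:R.
  have := @archi_boundP R (C * #|V|%:R); rewrite mulr_ge0 ?(ltW C0) // => /(_ isT) h.
  by rewrite (le_trans (ltW h)) // ler_nat.
set M := max_steps V T.
pose tp (vz : {ffun 'I_N.+1 -> V} *
    {ffun 'I_N.+1 * 'I_M.+1 -> bool * {ffun 'I_#|V|.+1 -> bool}}) : tape R V :=
  finite_tape (fun i => vz.1 (inord i))
  (fun a : bool * {ffun 'I_#|V|.+1 -> bool} => a.1) (fun a => representative p a.2) vz.2.
pose cost vz := sampling_cost G beta C p T tb k (tp vz) N.+1.
have costE x : sampling_time G beta C p T tb k (w x) = (cost (discrete_tape p w N M
  x))%:E.
  rewrite (sampling_timeE _ _ _ _ kA V1 _ CN) /cost /sampling_cost; congr _%:E.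
  have ag := @tapes_agree_discrete _ _ p T N _ _ w x.
  apply: eq_bigr => i _; rewrite /continues.
  have agi j : (j <= N.+1)%N -> tapes_agree p T j (w x) (tp (discrete_tape p w N M x)).
    by move=> jN l lj; apply: ag; exact: leq_trans lj jN.
  rewrite (sampling_at_agree G beta C tb (agi i (ltnW (ltn_ord i)))).
  by rewrite (run_cost_agree G beta tb k (agi i.+1 (ltn_ord i))).
rewrite (eq_integral _ _ (fun x _ => costE x)).
rewrite (@integral_finite_valued _ _ _ P _ (discrete_tape p w N M)
  (measurable_discrete_tape hw (N := N) (M := M)) cost) => [|vz]; last first.
  by apply: sumr_ge0 => i _; rewrite mulr_ge0 // (run_cost_ge0 _ _ _ _ kA V1).
set bound := (X in (_ <= X%:E)%E).
pose mu := law (N := N) (M := M) p P w.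
have bound_le vs : mean mu (fun z => cost (vs, z)) <= bound.
  apply: (le_trans (@mean_sampling_cost R V G beta C p T tb k A kA V1 hp N
    (fun i => vs (inord i)) _ (fun a : bool * {ffun 'I_#|V|.+1 -> bool} => a.1)
    (fun a => representative p a.2) mu
    (law_ge0 P w hp (N := N) (M := M)) (sum_law hp V1 hw (N := N) (M := M))
    (law_levels hp hw (N := N) (M := M))
    f e f0 e1 f_decr f_drift B e0 eB f_low C0)).
  rewrite -/K2 /bound.
  set D := (maxn 1 _)%:R; set l := ln #|V|%:R.
  have l1 : 1 <= 2 * l := ln_card_ge R V1.
  have Al : A * l <= (`|A| + 1) * (2 * l * l).
    have l0 : 0 <= l by lra.
    apply: ler_pM => //; first by rewrite (le_trans ler01) // (cost_const_ge1 kA).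
      by rewrite (le_trans (ler_norm A)) // lerDl.
    by rewrite ler_peMl.
  have W0 : 0 <= D * (10 + 7 * K2) * ((C + 1) * #|V|%:R).
    by apply: mulr_ge0; apply: mulr_ge0 => //;
      [rewrite addr_ge0 // mulr_ge0|rewrite addr_ge0 // ltW].
  rewrite [leLHS](_ : _ = A * l * (D * (10 + 7 * K2) * ((C + 1) * #|V|%:R)));
    last by ring.
  rewrite [leRHS](_ : _ = (`|A| + 1) * (2 * l * l) * (D * (10 + 7 * K2) * ((C + 1) *
    #|V|%:R))); last by ring.
  by rewrite ler_wpM2r.
rewrite (eq_bigr (fun vz : {ffun 'I_N.+1 -> V} *
    {ffun 'I_N.+1 * 'I_M.+1 -> bool * {ffun 'I_#|V|.+1 -> bool}} =>
    ((\prod_(i < N.+1) #|V|%:R^-1) * (weight mu vz.2 * cost vz))%:E)) => [|[vs z] _];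
      last first.
  by rewrite (prob_discrete_tape hw) -EFinM mulrC mulrA.
rewrite sumEFin lee_fin.
rewrite -(pair_bigA _ (fun vs z => \prod_(i < N.+1) #|V|%:R^-1 * (weight mu z * cost
  (vs, z)))) /=.
apply: (@le_trans _ _ (\sum_(vs : {ffun 'I_N.+1 -> V}) \prod_(i < N.+1) #|V|%:R^-1 *
  bound)).
  apply: ler_sum => vs _; rewrite -mulr_sumr ler_wpM2l //.
    by apply: prodr_ge0 => i _; rewrite invr_ge0.
  exact: bound_le.
(* The weights of the tuples of start vertices sum to 1. *)
rewrite -mulr_suml -(bigA_distr_bigA (fun (_ : 'I_N.+1) (_ : V) => #|V|%:R^-1)) big1
  ?mul1r // => i _.
by rewrite sumr_const -[LHS]mulr_natr mulVf // pnatr_eq0 -lt0n ltnW.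
Qed.
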